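(* Let $f:\mathbb{C}\to\mathbb{C}$ be given by $f(z)=z+1+e^{-z}$. Then the escaping set $I(f)=\{z\in\mathbb{C}: f^n(z)\to\infty \text{ as } n\to\infty\}$ is a spider's web.
   Context: $f^n$ denotes the $n$th iterate of $f$, and $\mathbb{N}=\{1,2,\dots\}$. A set $E\subset\mathbb{C}$ is an (infinite) spider's web if $E$ is connected and there exists a sequence $(G_n)_{n\in\mathbb{N}}$ of bounded simply connected domains with $G_n\subset G_{n+1}$ and $\partial G_n\subset E$ for all $n\in\mathbb{N}$, and $\bigcup_{n\in\mathbb{N}}G_n=\mathbb{C}$. *)

(* Defs.v *)
From HB Require Import structures.
From mathcomp Require Import all_boot all_order all_algebra.
From mathcomp Require Import complex.
From mathcomp Require Import all_classical all_reals all_analysis.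

Set Implicit Arguments.
Unset Strict Implicit.
Unset Printing Implicit Defensive.

Import Order.TTheory GRing.Theory Num.Theory.
Import numFieldNormedType.Exports.

Local Open Scope classical_set_scope.
Local Open Scope ring_scope.
Local Open Scope complex_scope.

(* The topology and norm that every numFieldType carries, made canonical on
   R[i]; this is the usual topology of the complex plane. *)
#[non_forgetful_inheritance]
HB.instance Definition _ (R : realType) := GRing.ComAlgebra.copy R[i] R[i]^o.
#[non_forgetful_inheritance]
HB.instance Definition _ (R : realType) := Vector.copy R[i] R[i]^o.
#[non_forgetful_inheritance]
HB.instance Definition _ (R : realType) := NormedModule.copy R[i] R[i]^o.

Definition boundary (T : topologicalType) (A : set T) : set T :=
  closure A `\` interior A.

Definition domain (T : topologicalType) (G : set T) : Prop :=
  [/\ G !=set0, open G & connected G].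

Definition path_in (R : realType) (T : topologicalType) (G : set T)
    (x y : T) (gamma : R -> T) : Prop :=
  [/\ {within `[0, 1], continuous gamma},
      gamma @` `[0, 1] `<=` G, gamma 0 = x & gamma 1 = y].

(* H (s, t): t is the path parameter, s the deformation parameter; the base
   point x is kept fixed throughout the deformation. *)
Definition null_homotopic (R : realType) (T : topologicalType) (G : set T)
    (x : T) (gamma : R -> T) : Prop :=
  exists H : R * R -> T,
    [/\ {within `[0, 1] `*` `[0, 1], continuous H},
        H @` (`[0, 1] `*` `[0, 1]) `<=` G,
        (forall t : R, 0 <= t <= 1 -> H (0, t) = gamma t),
        (forall t : R, 0 <= t <= 1 -> H (1, t) = x) &
        (forall s : R, 0 <= s <= 1 -> H (s, 0) = x /\ H (s, 1) = x)].

Definition simply_connected (R : realType) (T : topologicalType)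
    (G : set T) : Prop :=
  (forall x y, G x -> G y -> exists gamma : R -> T, path_in G x y gamma) /\
  (forall x (gamma : R -> T), path_in G x x gamma -> null_homotopic G x gamma).

Definition spiders_web (R : realType) (E : set R[i]) : Prop :=
  connected E /\
  exists G : nat -> set R[i],
    (forall n, [/\ domain (G n), simply_connected R (G n),
                   bounded_set (G n), G n `<=` G n.+1 &
                   boundary (G n) `<=` E]) /\
    \bigcup_n G n = setT.

(* Used with K := R[i]: the norm takes its values in K, and the filter +oo of K
   is generated by the sets [set w | M < w] with M real. *)
Definition escaping_set (K : numFieldType) (f : K -> K) : set K :=
  [set z | `|iter n f z| @[n --> \oo] --> +oo].

Definition cexp (R : realType) (z : R[i]) : R[i] :=
  let: x +i* y := z in (expR x * cos y) +i* (expR x * sin y).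

Definition fatou_map (R : realType) (z : R[i]) : R[i] := z + 1 + cexp (- z).

(* Main.v *)
(** The map f is periodic up to translation and maps each open strip
    2 pi j < Im z < 2 pi (j + 1) conformally onto the plane slit along two
    horizontal half-lines lying in Re >= 2; in particular every w with Re w < 2
    has exactly one preimage in each strip, depending continuously on w. The
    lines Im z = 2 pi j and the half-plane Re z >= 1 are invariant and escape.

    Take rectangles of tower-like growing sizes a n, with f (box n) inside
    box (n + 1), and let G n be the set of points whose orbit eventually enters
    these boxes, while never crossing the top, bottom (which are escaping lines)
    or right side (which lies in Re >= 1) of the current box. A boundary
    point of G n either reaches such a side or stays outside all the boxes; it
    escapes in both cases. G n is bounded since a point far to the left of a box
    either leaves through the three other sides or lands far to the left of the
    next box. It is an increasing union of sets which are contracted by lifting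
    deformations through the inverse branches and then pushing points to the
    right.

    Finally the points whose orbit reaches Re >= 1 or a line form a connected
    set (lift paths by the branches) which is dense: where Re f <= 1 one has
    |f'|^2 = 1 - 2 exp (- x) cos y + exp (- 2 x) >= 1 + 2 x + exp (- 2 x) >= 2,
    so the distance to this set is contracted by the branches. As this set lies
    in the escaping set, the latter is connected. *)
Require Import Defs.
From mathcomp Require Import all_boot all_order all_algebra.
From mathcomp Require Import complex.
From mathcomp Require Import all_classical all_reals all_analysis.
From mathcomp Require Import ring lra zify.

Set Implicit Arguments.
Unset Strict Implicit.
Unset Printing Implicit Defensive.

Import Order.TTheory GRing.Theory Num.Theory.
Import numFieldNormedType.Exports.

Local Open Scope classical_set_scope.
Local Open Scope ring_scope.

(** * The map in real coordinates *)

Section FatouMap.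
Variable R : realType.
Implicit Types (x y u v : R) (z w : R * R) (j : int).

(** Working in [R * R] keeps all estimates real; the last part carries the results over to
    [R[i]]. *)
Definition fatou_plane z : R * R :=
  (z.1 + 1 + expR (- z.1) * cos z.2, z.2 - expR (- z.1) * sin z.2).

Local Notation F := fatou_plane.
Local Notation tau := (2 * @pi R).

Definition shift j z : R * R := (z.1, z.2 + j%:~R * tau).

Lemma periodic_int (V : zmodType) (g : R -> V) (T : R) y j :
  periodic g T -> g (y + j%:~R * T) = g y.
Proof.
move=> gT; case: j => n.
  by rewrite -[n%:~R]/(n%:R) mulr_natl periodicn.
rewrite NegzE mulrNz mulNr -[n.+1%:~R]/(n.+1%:R) -[in RHS](subrK (n.+1%:R * T) y).
by rewrite [in RHS]mulr_natl periodicn // mulr_natl.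
Qed.

Lemma sin_shift y j : sin (y + j%:~R * tau) = sin y.
Proof. by apply: periodic_int; rewrite mulr_natl; apply: sinD2pi. Qed.

Lemma cos_shift y j : cos (y + j%:~R * tau) = cos y.
Proof. by apply: periodic_int; rewrite mulr_natl; apply: cosD2pi. Qed.

Lemma fatou_shift j z : F (shift j z) = shift j (F z).
Proof.
rewrite /F /shift sin_shift cos_shift /=.
by congr (_, _); rewrite addrAC.
Qed.

Lemma shiftN j z : shift (- j) (shift j z) = z.
Proof. by case: z => x y; rewrite /shift/= mulrNz; congr (_, _); ring. Qed.

Lemma shiftNK j z : shift j (shift (- j) z) = z.
Proof. by rewrite -{1}(opprK j) shiftN. Qed.

Definition on_line z := exists j, z.2 = j%:~R * tau.

Definition strip j z :=
  j%:~R * tau < z.2 < j%:~R * tau + tau.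

Lemma strip_shift i j z : strip (i + j) (shift j z) <-> strip i z.
Proof.
rewrite /strip /shift /= intrD mulrDl.
by rewrite -addrA [_ + tau]addrC addrA !ltrD2r.
Qed.

Lemma line_or_strip z : on_line z \/ exists j, strip j z.
Proof.
have tau0 : 0 < tau by rewrite mulr_gt0 ?pi_gt0.
have := floor_itv (z.2 / tau); set j := Num.floor _ => /andP[h1 h2].
move: h1; rewrite ler_pdivlMr// le_eqVlt => /orP[/eqP h|h].
  by left; exists j.
right; exists j; rewrite /strip h /=.
by move: h2; rewrite ltr_pdivrMr// intrD mulrDl mul1r.
Qed.

Lemma expR_half : expR (- 1) <= 1 / 2 :> R.
Proof.
have h : 2 <= expR 1 :> R by have := expR_ge1Dx (1 : R); lra.
by rewrite expRN div1r lef_pV2 ?posrE ?expR_gt0.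
Qed.

Lemma fatou_re_ge z : z.1 - expR (- z.1) + 1 <= (F z).1.
Proof.
rewrite /F /=; have := cos_geN1 z.2; have := expR_gt0 (- z.1); nra.
Qed.

(** Here the exponential term has modulus at most 1 / e <= 1 / 2, so at least half of the
    translation by 1 survives. *)
Lemma fatou_re_right z : 1 <= z.1 -> z.1 + 1 / 2 <= (F z).1.
Proof.
move=> h; have h1 := fatou_re_ge z.
have h2 : expR (- z.1) <= 1 / 2.
  by apply: le_trans expR_half; rewrite ler_expR lerN2.
lra.
Qed.

(** On such a line [F] acts as x -> x + 1 + exp (- x), and exp (- x) >= 1 - x. *)
Lemma fatou_line z : on_line z -> on_line (F z) /\ 2 <= (F z).1.
Proof.
case=> j e; have s0 : sin z.2 = 0 by rewrite e -[_ * _]add0r sin_shift sin0.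
have c1 : cos z.2 = 1 by rewrite e -[_ * _]add0r cos_shift cos0.
split; first by exists j; rewrite /F/= s0 mulr0 subr0.
by rewrite /F/= c1 mulr1; have := expR_ge1Dx (- z.1); lra.
Qed.

(** The maximum norm lets one large coordinate suffice; it is dominated by the modulus used in
    [escaping_set]. *)
Definition escapes z :=
  forall M : R, \forall n \near \oo, M < Num.max `|(iter n F z).1| `|(iter n F z).2|.

Lemma escapesF z : escapes (F z) -> escapes z.
Proof.
move=> h M; have [N _ hN] := h M; exists N.+1 => // -[//|n] /= hn.
by have := hN n hn; rewrite -iterSr.
Qed.

Lemma right_escapes z : 1 <= z.1 -> escapes z.
Proof.
move=> z1 M; have h n : 1 + n%:R / 2 <= (iter n F z).1.
  elim: n => [|n IH]; first by rewrite mul0r addr0.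
  rewrite iterS; have := @fatou_re_right (iter n F z).
  have n0 : 0 <= n%:R / 2 :> R by rewrite divr_ge0.
  have h1 : 1 <= (iter n F z).1 by lra.
  by move=> /(_ h1); rewrite -(natr1 n); lra.
exists (Num.trunc (M * 2)).+1 => // n /= hn.
rewrite lt_max; apply/orP; left; apply: lt_le_trans (ler_norm _).
apply: lt_le_trans (h n).
have : M * 2 < n%:R by apply: lt_le_trans (truncnS_gt _) _; rewrite ler_nat.
lra.
Qed.

Lemma line_escapes z : on_line z -> escapes z.
Proof.
by move=> /fatou_line[_ h]; apply: escapesF; apply: right_escapes; lra.
Qed.

End FatouMap.
(** * Inverse branches on the strips *)

Section InverseBranch.
Variable R : realType.
Implicit Types (x y u v : R) (z w : R * R) (j : int).
Local Notation F := (@fatou_plane R).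
Local Notation tau := (2 * @pi R).

(* Along the segment from [z] to [w], the imaginary part of
   [conj (w - z) * F] has derivative [|w - z|^2 * exp (- x) * sin y > 0]. *)
Lemma fatou_inj_half z w : 0 < z.2 < pi -> 0 < w.2 < pi -> F z = F w -> z = w.
Proof.
move=> hz hw e.
pose a := w.1 - z.1; pose b := w.2 - z.2.
pose X (t : R) := z.1 + a * t; pose Y (t : R) := z.2 + b * t.
pose phi t := a * (Y t - expR (- X t) * sin (Y t))
              - b * (X t + 1 + expR (- X t) * cos (Y t)).
pose dphi t := (a ^+ 2 + b ^+ 2) * (expR (- X t) * sin (Y t)).
have dX (t : R) : is_derive t 1 X a.
  by apply: is_derive_eq; rewrite /GRing.scale/=; ring.
have dY (t : R) : is_derive t 1 Y b.
  by apply: is_derive_eq; rewrite /GRing.scale/=; ring.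
have dE (t : R) : is_derive t 1 (fun t => expR (- X t)) (- a * expR (- X t)).
  by apply: is_derive_eq; rewrite /GRing.scale/=; ring.
have dS (t : R) : is_derive t 1 (fun t => sin (Y t)) (b * cos (Y t)).
  by apply: is_derive_eq; rewrite /GRing.scale/=; ring.
have dC (t : R) : is_derive t 1 (fun t => cos (Y t)) (- b * sin (Y t)).
  by apply: is_derive_eq; rewrite /GRing.scale/=; ring.
have dph (t : R) : is_derive t 1 phi (dphi t).
  by apply: is_derive_eq; rewrite /GRing.scale/= /dphi; ring.
have [t tI] : exists2 c, c \in `]0, 1[ & phi 1 - phi 0 = dphi c * (1 - 0).
  by apply: MVT => //; apply: derivable_within_continuous => t _; have [] := dph t.
have -> : phi 1 = phi 0.
  have -> : phi 1 = a * (F w).2 - b * (F w).1.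
    by rewrite /phi /X /Y /a /b /F !mulr1 !subrKC.
  by rewrite -e /phi /X /Y !mulr0 !addr0.
rewrite subrr subr0 mulr1 /dphi => /esym/eqP.
rewrite in_itv /= in tI; case/andP: tI => t0 t1.
have s0 : 0 < sin (Y t).
  apply: sin_gt0_pi; rewrite /Y /b; move: hz hw => /andP[? ?] /andP[? ?].
  apply/andP; split; nra.
rewrite mulf_eq0 [X in _ || X]gt_eqF ?mulr_gt0 ?expR_gt0// orbF.
rewrite paddr_eq0 ?sqr_ge0// !sqrf_eq0 => /andP[/eqP ea /eqP eb].
have [e1 e2] : z.1 = w.1 /\ z.2 = w.2 by move: ea eb; rewrite /a /b; split; lra.
by rewrite [z]surjective_pairing [w]surjective_pairing e1 e2.
Qed.


Definition reflect_strip z : R * R := (z.1, tau - z.2).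

Lemma reflect_stripK : involutive reflect_strip.
Proof. by case=> x y; rewrite /reflect_strip/= subKr. Qed.

Lemma fatou_reflect z : F (reflect_strip z) = reflect_strip (F z).
Proof.
have e : tau - z.2 = - z.2 + (1 : int)%:~R * tau by rewrite mul1r addrC.
rewrite /F /reflect_strip /= e sin_shift cos_shift sinN cosN -e.
by congr (_, _); ring.
Qed.

Lemma fatou_below_pi z : 0 < z.2 < pi -> (F z).2 < pi.
Proof.
move=> hz; have := sin_gt0_pi hz; have := expR_gt0 (- z.1).
by rewrite /F/= => h1 h2; have := mulr_gt0 h1 h2; case/andP: hz; lra.
Qed.

Lemma fatou_above_pi z : pi < z.2 < tau -> pi < (F z).2.
Proof.
move=> hz; have : 0 < (reflect_strip z).2 < pi.
  by rewrite /reflect_strip/=; case/andP: hz => ? ?; apply/andP; split; lra.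
by move/fatou_below_pi; rewrite fatou_reflect /reflect_strip /=; lra.
Qed.

Lemma fatou_at_pi z : z.2 = pi -> F z = (z.1 + 1 - expR (- z.1), pi).
Proof. by rewrite /F => ->; rewrite sinpi cospi mulr0 subr0 mulrN1. Qed.

(** [F] sends the lower half of the strip below height pi, the upper half above it and the middle
    line into it, so only points of the same part can collide. The upper half reduces to the lower
    one by reflection; on the middle line x + 1 - exp (- x) is strictly increasing. *)
Lemma fatou_inj0 z w : strip 0 z -> strip 0 w -> F z = F w -> z = w.
Proof.
rewrite /strip mul0r add0r => hz hw e.
case: (ltgtP z.2 pi) => zp.
- have hz' : 0 < z.2 < pi by rewrite zp andbT; case/andP: hz.
  have wp := fatou_below_pi hz'; rewrite e in wp.
  case: (ltgtP w.2 pi) => wp'.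
  + apply: fatou_inj_half => //; rewrite wp' andbT; by case/andP: hw.
  + have : pi < (F w).2 by apply: fatou_above_pi; rewrite wp'; case/andP: hw.
    by move=> wpi; exfalso; clear e; lra.
  + by move: wp; rewrite fatou_at_pi //= ltxx.
- have hz' : pi < z.2 < tau by rewrite zp; case/andP: hz.
  have wp := fatou_above_pi hz'; rewrite e in wp.
  case: (ltgtP w.2 pi) => wp'.
  + have : (F w).2 < pi by apply: fatou_below_pi; rewrite wp' andbT; case/andP: hw.
    by move=> wpi; exfalso; clear e; lra.
  + apply: (can_inj reflect_stripK); apply: fatou_inj_half.
    * by rewrite /reflect_strip /=; case/andP: hz' => ? ?; apply/andP; split; lra.
    * by rewrite /reflect_strip /=; case/andP: hw => ? ?; apply/andP; split; lra.
    * by rewrite !fatou_reflect e.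
  + by move: wp; rewrite fatou_at_pi //= ltxx.
- have ez : (F z).2 = pi by rewrite fatou_at_pi.
  rewrite e in ez.
  case: (ltgtP w.2 pi) => wp'.
  + have : (F w).2 < pi by apply: fatou_below_pi; rewrite wp' andbT; case/andP: hw.
    by move=> wpi; exfalso; clear e; lra.
  + have : pi < (F w).2 by apply: fatou_above_pi; rewrite wp'; case/andP: hw.
    by move=> wpi; exfalso; clear e; lra.
  + move: e; rewrite !fatou_at_pi // => -[e].
    rewrite [z]surjective_pairing [w]surjective_pairing zp wp'; congr (_, _).
    have := ltr_expR (- z.1) (- w.1); have := ltr_expR (- w.1) (- z.1).
    rewrite !ltrN2; case: (ltgtP z.1 w.1) => // ? ? ?; exfalso; lra.
Qed.

Lemma continuous_gt0_ball (g : R -> R) x : {for x, continuous g} -> 0 < g x ->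
  exists2 e : R, 0 < e & forall y, `|y - x| < e -> 0 < g y.
Proof.
move=> gc gx; have : \forall y \near x, 0 < g y.
  by move: gc => /cvgr_gt; apply.
move=> /nbhs_ballP[e /= e0 he]; exists e => // y hy; apply: he.
by rewrite /ball/= distrC.
Qed.


(* The imaginary part of [F (x, y) = (u, v)] gives [exp (- x) = E y]; the real
   part becomes [Phi y = u], solved by the intermediate value theorem. *)
Lemma fatou_surj_half w : w.1 < 2 -> w.2 < pi ->
  exists2 z, 0 < z.2 < pi & F z = w.
Proof.
case: w => u v /= u2 vpi.
pose E (y : R) := (y - v) / sin y.
pose Phi y := 1 - ln (E y) + E y * cos y.
(* Between [lo] and pi both y - v and sin y are positive, so [E y] has a logarithm. *)
pose lo := Num.max 0 v.
have lopi : lo < pi by rewrite /lo gt_max pi_gt0 vpi.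
have Epos y : lo < y < pi -> 0 < E y.
  rewrite /lo gt_max => /andP[/andP[y0 yv] yp]; apply: divr_gt0; first by lra.
  by apply: sin_gt0_pi; rewrite y0 yp.
have cE y : lo < y < pi -> {for y, continuous E}.
  move=> hy; have s0 : sin y != 0.
    rewrite gt_eqF // sin_gt0_pi //; move: hy; rewrite /lo gt_max.
    by case/andP => /andP[-> _] ->.
  apply: cvgM; first by apply: cvgB; [exact: cvg_id|exact: cvg_cst].
  by apply: cvgV => //; exact: continuous_sin.
have cPhi y : lo < y < pi -> {for y, continuous Phi}.
  move=> hy; apply: cvgD.
    apply: cvgB; first exact: cvg_cst.
    apply: continuous_comp; first exact: cE.
    by apply: continuous_ln; exact: Epos.
  by apply: cvgM; [exact: cE|exact: continuous_cos].
have [y1 hy1 Py1] : exists2 y, lo < y < pi & u < Phi y.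
  (* If v <= 0, the inequality ln t <= t - 1 at t = E y cos y gives Phi y >= 2 + ln (cos y), which
     exceeds u near y = 0 because u < 2. *)
  have [v0|v0] := leP v 0.
    have lo0 : lo = 0 by rewrite /lo max_l.
    pose g (y : R) := cos y - expR (u - 2).
    have [||e e0 he] := @continuous_gt0_ball g 0.
    - by apply: cvgB; [exact: continuous_cos|exact: cvg_cst].
    - rewrite /g cos0 subr_gt0 -[X in _ < X]expR0 ltr_expR; lra.
    have pi0 := pi_gt0 R.
    pose y := Num.min e pi / 2.
    have hm : 0 < Num.min e pi by rewrite lt_min e0 pi0.
    have hy : lo < y < pi.
      have : Num.min e pi <= pi by rewrite ge_min lexx orbT.
      by rewrite lo0 /y => ?; apply/andP; split; lra.
    have cy : 0 < g y.
      apply: he; rewrite subr0 ger0_norm; last by rewrite /y; lra.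
      have : Num.min e pi <= e by rewrite ge_min lexx.
      rewrite /y; lra.
    exists y => //; rewrite /Phi; have E0 := Epos y hy.
    have c0 : 0 < cos y by move: cy; rewrite /g; have := expR_gt0 (u - 2); lra.
    have lnc : u - 2 < ln (cos y).
      by rewrite -ltr_expR lnK ?posrE//; move: cy; rewrite /g; lra.
    have : ln (1 + (E y * cos y - 1)) <= E y * cos y - 1.
      by apply: le_ln1Dx; have := mulr_gt0 E0 c0; lra.
    rewrite subrKC lnM ?posrE//; lra.
  (* If v > 0, then [E] vanishes at v; just above v it is below 1 and exp (- u), so - ln (E y) > u
     while 1 + E y cos y > 0. *)
  have lov : lo = v by rewrite /lo max_r // ltW.
  have sv : 0 < sin v by rewrite sin_gt0_pi // v0.
  pose d := Num.min 1 (expR (- u)).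
  have d0 : 0 < d by rewrite lt_min ltr01 expR_gt0.
  pose g (y : R) := d - E y.
  have [||e e0 he] := @continuous_gt0_ball g v.
  - apply: cvgB; first exact: cvg_cst.
    apply: cvgM; first by apply: cvgB; [exact: cvg_id|exact: cvg_cst].
    by apply: cvgV; rewrite ?gt_eqF//; exact: continuous_sin.
  - by rewrite /g /E subrr mul0r subr0.
  pose m := Num.min e (pi - v).
  have hm : 0 < m by rewrite lt_min e0 subr_gt0.
  have mp : m <= pi - v by rewrite ge_min lexx orbT.
  have me : m <= e by rewrite ge_min lexx.
  pose y := v + m / 2.
  have hy : lo < y < pi by rewrite lov /y; apply/andP; split; lra.
  have : 0 < g y by apply: he; rewrite /y addrC addKr ger0_norm; lra.
  rewrite subr_gt0 lt_min => /andP[E1 Eu].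
  exists y => //; rewrite /Phi; have E0 := Epos y hy.
  have : ln (E y) < - u by rewrite -ltr_expR lnK ?posrE.
  have := cos_geN1 y; nra.
have [y2 hy2 Py2] : exists2 y, lo < y < pi & Phi y < u.
  (* Near pi one has E y > B >= 1 and cos y < - 1 / 2, hence Phi y < 1 - B / 2 <= u. *)
  pose B := Num.max 1 (2 * (1 - u)).
  have B1 : 1 <= B by rewrite le_max lexx.
  have Bu : 2 * (1 - u) <= B by rewrite le_max lexx orbT.
  pose g (y : R) := y - v - B * sin y.
  pose h (y : R) := - (1 / 2) - cos y.
  have [||e e0 he] := @continuous_gt0_ball g pi.
  - apply: cvgB; first by apply: cvgB; [exact: cvg_id|exact: cvg_cst].
    by apply: cvgM; [exact: cvg_cst|exact: continuous_sin].
  - by rewrite /g sinpi mulr0 subr0 subr_gt0.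
  have [||e' e'0 he'] := @continuous_gt0_ball h pi.
  - by apply: cvgB; [exact: cvg_cst|exact: continuous_cos].
  - by rewrite /h cospi; lra.
  pose m := Num.min (Num.min e e') (pi - lo).
  have hm : 0 < m by rewrite !lt_min e0 e'0 subr_gt0.
  have mp : m <= pi - lo by rewrite ge_min lexx orbT.
  have me : m <= e by rewrite !ge_min lexx.
  have me' : m <= e' by rewrite !ge_min lexx orbT.
  pose y := pi - m / 2.
  have hy : lo < y < pi by rewrite /y; apply/andP; split; lra.
  have ye : `|y - pi| = m / 2 by rewrite /y addrC addKr normrN ger0_norm //; lra.
  have : 0 < g y by apply: he; rewrite ye; lra.
  have : 0 < h y by apply: he'; rewrite ye; lra.
  rewrite /h => cy gy; exists y => //.
  have s0 : 0 < sin y.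
    apply: sin_gt0_pi; move: hy; rewrite /lo gt_max.
    by case/andP => /andP[-> _] ->.
  have EB : B < E y by rewrite ltr_pdivlMr //; move: gy; rewrite /g; lra.
  have : 0 <= ln (E y) by apply: ln_ge0; lra.
  rewrite /Phi; nra.
have [y hy Py] : exists2 y, lo < y < pi & Phi y = u.
  have between a b y : lo < a < pi -> lo < b < pi -> y \in `[a, b] -> lo < y < pi.
    rewrite in_itv/= => /andP[? ?] /andP[? ?] /andP[? ?]; apply/andP; split; lra.
  have ct a b : lo < a < pi -> lo < b < pi -> {within `[a, b], continuous Phi}.
    move=> ha hb; apply: continuous_in_subspaceT => y.
    by rewrite inE/= => /(between _ _ _ ha hb)/cPhi.
  case: (leP y1 y2) => hh.
    have [|y yin <-] := IVT hh (ct _ _ hy1 hy2) (v := u).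
      by rewrite ge_min le_max (ltW Py1) (ltW Py2) orbT.
    by exists y => //; exact: (between _ _ _ hy1 hy2).
  have [|y yin <-] := IVT (ltW hh) (ct _ _ hy2 hy1) (v := u).
    by rewrite ge_min le_max (ltW Py1) (ltW Py2) orbT.
  by exists y => //; exact: (between _ _ _ hy2 hy1).
have s0 : 0 < sin y.
  apply: sin_gt0_pi; move: hy; rewrite /lo gt_max.
  by case/andP => /andP[-> _] ->.
exists (- ln (E y), y).
  by move: hy; rewrite /lo gt_max => /andP[/andP[-> _] ->].
rewrite /F /= opprK lnK ?posrE ?Epos//; congr (_, _).
  by rewrite -Py /Phi; ring.
by rewrite /E divfK ?gt_eqF// subKr.
Qed.

End InverseBranch.

(** * Branches on all strips and their continuity *)

Section Branches.
Variable R : realType.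
Implicit Types (x y u v : R) (z w : R * R) (j : int).
Local Notation F := (@fatou_plane R).
Local Notation tau := (2 * @pi R).

Lemma continuous_pair (T U V : topologicalType) (f : T -> U) (g : T -> V) (t : T) :
  {for t, continuous f} -> {for t, continuous g} ->
  {for t, continuous (fun s => (f s, g s))}.
Proof.
by move=> fc gc; exact: (@cvg_pair _ _ _ (nbhs t) (nbhs (f t)) (nbhs (g t))).
Qed.

Lemma continuous_fst : continuous (@fst R R).
Proof. by move=> z; exact: cvg_fst. Qed.

Lemma continuous_snd : continuous (@snd R R).
Proof. by move=> z; exact: cvg_snd. Qed.

Lemma continuous_fatou : continuous F.
Proof.
move=> z.
have cE : {for z, continuous (fun z => expR (- z.1) : R)}.
  apply: (@continuous_comp _ _ _ (fun z => - z.1) expR).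
    by apply: cvgN; exact: continuous_fst.
  exact: continuous_expR.
apply: (@continuous_pair _ R R (fun z => z.1 + 1 + expR (- z.1) * cos z.2)
  (fun z => z.2 - expR (- z.1) * sin z.2)).
  apply: cvgD; first by apply: cvgD; [exact: continuous_fst|exact: cvg_cst].
  apply: cvgM; first exact: cE.
  by apply: (@continuous_comp _ _ _ snd cos);
    [exact: continuous_snd|exact: continuous_cos].
apply: cvgB; first exact: continuous_snd.
apply: cvgM; first exact: cE.
by apply: (@continuous_comp _ _ _ snd sin);
  [exact: continuous_snd|exact: continuous_sin].
Qed.

Lemma fatou_inj j z w : strip j z -> strip j w -> F z = F w -> z = w.
Proof.
move=> hz hw e; apply: (can_inj (shiftN (- j))).
apply: fatou_inj0; last by rewrite !fatou_shift e.
  by rewrite -(subrr j); apply/strip_shift.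
by rewrite -(subrr j); apply/strip_shift.
Qed.

Lemma fatou_surj0 w : w.1 < 2 -> exists2 z, strip 0 z & F z = w.
Proof.
move=> w2; have pi0 := pi_gt0 R; case: (ltgtP w.2 pi) => wpi.
- have [z /andP[? ?] <-] := fatou_surj_half w2 wpi; exists z => //.
  by rewrite /strip mul0r add0r; apply/andP; split; lra.
- have [||z /andP[? ?] e] := @fatou_surj_half R (reflect_strip w).
  + by [].
  + by rewrite /=; lra.
  exists (reflect_strip z); last by rewrite fatou_reflect e reflect_stripK.
  by rewrite /strip mul0r add0r /=; apply/andP; split; lra.
- pose g x := x + 1 - expR (- x).
  have cg : continuous g.
    move=> x; apply: cvgB; first by apply: cvgD; [exact: cvg_id|exact: cvg_cst].
    apply: (@continuous_comp _ _ _ (fun x => - x) expR).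
      by apply: cvgN; exact: cvg_id.
    exact: continuous_expR.
  pose a := Num.min w.1 0.
  have a0 : a <= 0 by rewrite ge_min lexx orbT.
  have aw : a <= w.1 by rewrite ge_min lexx.
  have ga : g a <= w.1.
    by rewrite /g; have := expR_ge1Dx (- a); lra.
  have gb : w.1 <= g 2.
    have : expR (- 2) <= expR (- 1) :> R by rewrite ler_expR; lra.
    by rewrite /g; have := expR_half R; lra.
  have [|||x _ gx] := @IVT R g a 2 w.1; first by lra.
  + exact: continuous_subspaceT.
  + by rewrite ge_min le_max ga gb orbT.
  exists (x, pi).
    by rewrite /strip mul0r add0r /=; apply/andP; split; lra.
  by rewrite fatou_at_pi // [RHS]surjective_pairing wpi -gx.
Qed.

Lemma fatou_surj j w : w.1 < 2 -> exists2 z, strip j z & F z = w.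
Proof.
move=> w2; have [|z hz e] := @fatou_surj0 (shift (- j) w); first by [].
exists (shift j z); last by rewrite fatou_shift e shiftNK.
by rewrite -[j in strip j]add0r; apply/strip_shift.
Qed.

(** The default value [w] is returned only if the strip contains no preimage, which is excluded for
    [w.1 < 2]. *)
Definition branch j w : R * R := xget w [set z | strip j z /\ F z = w].

Lemma branchP j w : w.1 < 2 -> strip j (branch j w) /\ F (branch j w) = w.
Proof.
move=> w2; have [z hz e] := fatou_surj j w2.
by apply: (@xgetPex _ w [set z | strip j z /\ F z = w]); exists z.
Qed.

Lemma branchK j z : strip j z -> (F z).1 < 2 -> branch j (F z) = z.
Proof. by move=> hz /(branchP j)[h1 h2]; apply: (fatou_inj h1 hz h2). Qed.

(** Properness of [F] on a strip. For negative x, exp (- x) = |F z - z - 1| is at most linear in |x|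
    but also at least 1 + x^2 / 2, which bounds |x|. *)
Lemma fatou_proper z (C : R) : 0 <= C -> (F z).1 < 2 -> - (F z).1 <= C ->
  `|(F z).2| <= C -> `|z.2| <= C -> `|z.1| <= 3 * C + 4.
Proof.
move=> C0 h1 h2 h3 h4; rewrite ler_norml; apply/andP; split; last first.
  by have [/fatou_re_right|] := leP 1 z.1; lra.
have [x0|x0] := leP 0 z.1; first by lra.
have e1 := @expR_ge1Dxn R (- z.1) 1; rewrite sqrrN in e1.
have {}e1 : 1 + z.1 ^+ 2 / 2 <= expR (- z.1) by apply: e1; lra.
move: h3 h4; rewrite !ler_norml => /andP[h3 h3'] /andP[h4 h4'].
pose E := expR (- z.1); have E0 : 0 < E := expR_gt0 _.
have ec : E * cos z.2 = (F z).1 - z.1 - 1 by rewrite /E /F /=; ring.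
have es : E * sin z.2 = z.2 - (F z).2 by rewrite /E /F /=; ring.
have E2 : E ^+ 2 = ((F z).1 - z.1 - 1) ^+ 2 + (z.2 - (F z).2) ^+ 2.
  by rewrite -ec -es !exprMn -mulrDr cos2Dsin2 mulr1.
have EC : E <= - z.1 + 3 + 3 * C.
  rewrite -(@ler_pXn2r _ 2) ?nnegrE//; try lra.
  rewrite E2.
  have : ((F z).1 - z.1 - 1) ^+ 2 <= (1 - z.1 + C) ^+ 2.
    by rewrite -subr_ge0 subr_sqr mulr_ge0 //; lra.
  have : (z.2 - (F z).2) ^+ 2 <= (2 * C) ^+ 2.
    by rewrite -subr_ge0 subr_sqr mulr_ge0 //; lra.
  move: (_ ^+ 2) => A; move: ((F z).1 - z.1 - 1) => B; nra.
rewrite -/E in e1; nra.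
Qed.


Lemma plane_hausdorff : hausdorff_space (R * R)%type.
Proof. exact: (@norm_hausdorff R (R * R)%type). Qed.

(** By [fatou_proper], the branch maps a neighbourhood of [w] into a compact piece [K] of the closed
    strip. The part of [K] outside a given open neighbourhood [V] of the value at [w] has a compact
    image that misses [w], so nearby values lie in [V]. *)
Lemma branch_continuous j w : w.1 < 2 -> {for w, continuous (branch j)}.
Proof.
move=> w2 U; have [hz hF] := branchP j w2.
rewrite nbhsE => -[V [Vo Vz] VU].
pose C := `|w.1| + `|w.2| + 1 + `|j%:~R * tau| + tau.
have pi0 := pi_gt0 R.
have C0 : 0 <= C by rewrite /C !addr_ge0 // mulr_ge0 //; lra.
pose X := 3 * C + 4.
pose K := `[- X, X] `*` `[j%:~R * tau, j%:~R * tau + tau].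
have Kc : compact K by apply: compact_setX; apply: segment_compact.
have Dc : closed (F @` (K `&` ~` V)).
  apply: compact_closed; first exact: plane_hausdorff.
  apply: continuous_compact; first exact: (continuous_subspaceT continuous_fatou).
  by apply: compact_closedI => //; exact: open_closedC.
have wD : ~ (F @` (K `&` ~` V)) w.
  move=> [z [[z1K z2K] zV] e]; apply: zV.
  suff -> : z = branch j w by [].
  apply: (@fatou_inj j) => //; last by rewrite e.
  (* The two edges of the closed strip are lines, whose images have real part at least 2, so they do
     not meet the fibre of [w]. *)
  move: z2K => /=; rewrite in_itv/= /strip => /andP[].
  rewrite le_eqVlt => /orP[/eqP e2|->] h.
    by have [] := @fatou_line R z; [exists j|move=> _; rewrite e; lra].
  move: h; rewrite le_eqVlt => /orP[/eqP e2|->//].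
  have [] := @fatou_line R z; last by move=> _; rewrite e; lra.
  by exists (j + 1); rewrite e2 intrD; ring.
have nD : \forall w' \near w, ~ (F @` (K `&` ~` V)) w'.
  by apply: open_nbhs_nbhs; split => //; exact: closed_openC.
have n1 : \forall w' \near w, w'.1 < 2.
  by have /cvgr_lt := @continuous_fst w; apply.
have n2 : \forall w' \near w, `|w'.1| < `|w.1| + 1.
  by have /cvg_norm/cvgr_lt := @continuous_fst w; apply; rewrite ltrDl.
have n3 : \forall w' \near w, `|w'.2| < `|w.2| + 1.
  by have /cvg_norm/cvgr_lt := @continuous_snd w; apply; rewrite ltrDl.
suff : \forall w' \near w, U (branch j w') by [].
near=> w'; apply: VU; apply: contrapT => nV.
have w'2 : w'.1 < 2 by near: w'.
have [hz' hF'] := branchP j w'2.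
have : ~ (F @` (K `&` ~` V)) w' by near: w'.
apply; exists (branch j w') => //; split => //.
have b1 : `|w'.1| < `|w.1| + 1 by near: w'.
have b2 : `|w'.2| < `|w.2| + 1 by near: w'.
have := normr_ge0 w.1; have := normr_ge0 w.2.
have := ler_norm (- w'.1); rewrite normrN => a1 a2 a3.
have a4 : `|(branch j w').2| <= `|j%:~R * tau| + tau.
  move: hz'; rewrite /strip => /andP[s1 s2].
  rewrite ler_norml; have := ler_norm (j%:~R * tau); have := ler_norm (- (j%:~R * tau)).
  by rewrite normrN => ? ?; apply/andP; split; lra.
have a5 := normr_ge0 (j%:~R * tau).
split => /=; last first.
  by move: hz'; rewrite /strip in_itv/= => /andP[? ?]; apply/andP; split; lra.
have : `|(branch j w').1| <= X.
  by apply: fatou_proper => //; rewrite ?hF' /C //; lra.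
by rewrite ler_norml in_itv.
Unshelve. all: by end_near.
Qed.

End Branches.
(** * Expansion *)

Section Expansion.
Variable R : realType.
Implicit Types (x y u v a b : R) (z w : R * R) (j : int).
Local Notation F := (@fatou_plane R).
Local Notation tau := (2 * @pi R).

(** The Euclidean norm, which the derivative of [F], a complex multiplication, scales exactly by its
    modulus; the norm of [R * R] is the maximum norm. *)
Definition enorm z : R := Num.sqrt (z.1 ^+ 2 + z.2 ^+ 2).

Lemma enorm_ge0 z : 0 <= enorm z.
Proof. exact: sqrtr_ge0. Qed.

Lemma enorm_sqr z : enorm z ^+ 2 = z.1 ^+ 2 + z.2 ^+ 2.
Proof. by rewrite sqr_sqrtr // addr_ge0 ?sqr_ge0. Qed.

Lemma enorm_le z a : 0 <= a -> z.1 ^+ 2 + z.2 ^+ 2 <= a ^+ 2 -> enorm z <= a.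
Proof. by move=> a0 h; rewrite -(@ler_pXn2r _ 2) ?nnegrE ?enorm_ge0// enorm_sqr. Qed.

Lemma enorm_ge z a : a ^+ 2 <= z.1 ^+ 2 + z.2 ^+ 2 -> a <= enorm z.
Proof.
have [a0 h|a0 _] := leP 0 a; last by rewrite (le_trans (ltW a0)) ?enorm_ge0.
by rewrite -(@ler_pXn2r _ 2) ?nnegrE ?enorm_ge0// enorm_sqr.
Qed.

Lemma enormD z w : enorm (z + w) <= enorm z + enorm w.
Proof.
apply: enorm_le; first by rewrite addr_ge0 ?enorm_ge0.
rewrite [leRHS]sqrrD !enorm_sqr -[(z + w).1]/(z.1 + w.1) -[(z + w).2]/(z.2 + w.2).
have : z.1 * w.1 + z.2 * w.2 <= enorm z * enorm w.
  have [h|h] := leP 0 (z.1 * w.1 + z.2 * w.2); last first.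
    by rewrite (le_trans (ltW h)) // mulr_ge0 ?enorm_ge0.
  rewrite -(@ler_pXn2r _ 2) ?nnegrE ?mulr_ge0 ?enorm_ge0// exprMn !enorm_sqr.
  have := sqr_ge0 (z.1 * w.2 - z.2 * w.1); nra.
by lra.
Qed.

Lemma enormN z : enorm (- z) = enorm z.
Proof. by rewrite /enorm /= !sqrrN. Qed.

Lemma enorm_dist z w : enorm (z - w) = enorm (w - z).
Proof. by rewrite -enormN opprB. Qed.

Lemma enormZ a z : enorm (a *: z) = `|a| * enorm z.
Proof.
by rewrite /enorm /= !exprMn -mulrDr sqrtrM ?sqr_ge0// sqrtr_sqr.
Qed.

Lemma enorm_le_sum z : enorm z <= `|z.1| + `|z.2|.
Proof.
apply: enorm_le; first by rewrite addr_ge0.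
by rewrite sqrrD !real_normK ?num_real// lerD2r lerDl mulrn_wge0 ?mulr_ge0.
Qed.

Lemma abs1_le_enorm z : `|z.1| <= enorm z.
Proof. by apply: enorm_ge; rewrite real_normK ?num_real// lerDl sqr_ge0. Qed.

Lemma abs2_le_enorm z : `|z.2| <= enorm z.
Proof. by apply: enorm_ge; rewrite real_normK ?num_real// lerDr sqr_ge0. Qed.

Lemma sin_abs_le b : `|sin b| <= `|b|.
Proof.
wlog b0 : b / 0 <= b.
  move=> h; have [|b0] := leP 0 b; first exact: h.
  by rewrite -normrN -sinN -[leRHS]normrN h // oppr_ge0 ltW.
have [|c _] := @MVT_segment R sin cos 0 b b0 (fun x _ => is_derive_sin x).
  exact/continuous_subspaceT/continuous_sin.
rewrite sin0 !subr0 => ->; rewrite normrM ler_piMl //; exact: cos_max.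
Qed.

Lemma one_sub_cos_le b : 0 <= 1 - cos b <= b ^+ 2.
Proof.
rewrite subr_ge0 cos_le1 /=.
have -> : cos b = 1 - 2 * sin (b / 2) ^+ 2.
  rewrite {1}(_ : b = b / 2 + b / 2) ?cosD; last by field.
  by have := cos2Dsin2 (b / 2); rewrite !expr2; lra.
have : sin (b / 2) ^+ 2 <= (b / 2) ^+ 2.
  rewrite -(real_normK (num_real (sin (b / 2)))) -(real_normK (num_real (b / 2))).
  by rewrite ler_pXn2r ?nnegrE ?normr_ge0 ?sin_abs_le.
by have := sqr_ge0 b; lra.
Qed.


Lemma sub_sin_le b : `|b| <= 1 -> `|b - sin b| <= b ^+ 2.
Proof.
wlog b0 : b / 0 <= b.
  move=> h b1; have [b0|b0] := leP 0 b; first exact: h.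
  have := h (- b); rewrite sinN -opprD !normrN sqrrN; apply => //.
  by rewrite oppr_ge0 ltW.
rewrite ger0_norm // => b1.
have [|c] := @MVT_segment R sin cos 0 b b0 (fun x _ => is_derive_sin x).
  exact/continuous_subspaceT/continuous_sin.
rewrite in_itv /= => /andP[c0 cb]; rewrite sin0 !subr0 => ->.
have /andP[h1 h2] := one_sub_cos_le c.
by rewrite ger0_norm; nra.
Qed.

Lemma expR_sub_le a : `|a| <= 1 / 2 -> 0 <= expR a - 1 - a <= 2 * a ^+ 2.
Proof.
rewrite ler_norml => /andP[a1 a2].
have h1 := expR_ge1Dx a; have h2 := expR_ge1Dx (- a).
have e : expR a * expR (- a) = 1 by rewrite -expRD subrr expR0.
have e0 := expR_gt0 a; apply/andP; split; first by lra.
have h3 : expR a * (1 - a) <= 1 by rewrite -[leRHS]e ler_pM2l.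
have h4 : (1 + a + 2 * a ^+ 2) * (1 - a) >= 1.
  have : 0 <= a ^+ 2 * (1 / 2 - a) by rewrite mulr_ge0 ?sqr_ge0//; lra.
  by lra.
have : expR a <= 1 + a + 2 * a ^+ 2.
  by rewrite -(@ler_pM2r _ (1 - a)); lra.
lra.
Qed.

(** With h = a + i b, the left side is |exp (- h) - 1 + h|, written through the conjugate. Its
    quadratic size is stated as a small multiple of |h|. *)
Lemma exp_remainder a b d : 0 <= d <= 1 / 2 -> `|a| <= d -> `|b| <= d ->
  enorm (expR (- a) * cos b - 1 + a, expR (- a) * sin b - b)
    <= 10 * d * enorm (a, b).
Proof.
move=> /andP[d0 d1] ad bd; apply: le_trans (enorm_le_sum _) _ => /=.
have /andP[e1 e2] : 0 <= expR (- a) - 1 + a <= 2 * a ^+ 2.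
  have := @expR_sub_le (- a); rewrite normrN sqrrN opprK; apply; lra.
have /andP[c1 c2] := one_sub_cos_le b.
have s1 := sin_abs_le b; have s2 : `|b - sin b| <= b ^+ 2 by apply: sub_sin_le; lra.
have A := abs1_le_enorm (a, b); have B := abs2_le_enorm (a, b); rewrite /= in A B.
have a2 : a ^+ 2 <= d * enorm (a, b).
  by rewrite -(real_normK (num_real a)) expr2 ler_pM.
have b2 : b ^+ 2 <= d * enorm (a, b).
  by rewrite -(real_normK (num_real b)) expr2 ler_pM.
have N0 := enorm_ge0 (a, b); have E0 := expR_gt0 (- a).
have ha : - d <= a <= d by rewrite -ler_norml.
have E2 : expR (- a) <= 2.
  by move: ha => /andP[? ?]; nra.
have r1 : `|expR (- a) * cos b - 1 + a| <= 4 * d * enorm (a, b).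
  have -> : expR (- a) * cos b - 1 + a
    = (expR (- a) - 1 + a) - expR (- a) * (1 - cos b) by ring.
  have : 0 <= expR (- a) * (1 - cos b) <= 2 * b ^+ 2.
    by apply/andP; split; [exact: mulr_ge0 (ltW E0) c1|apply: ler_pM => //; exact: ltW].
  by move=> /andP[? ?]; rewrite ler_norml; apply/andP; split; nra.
have r2 : `|expR (- a) * sin b - b| <= 6 * d * enorm (a, b).
  have -> : expR (- a) * sin b - b = (expR (- a) - 1) * sin b - (b - sin b) by ring.
  apply: le_trans (ler_normB _ _) _; rewrite normrM.
  have h : `|expR (- a) - 1| <= 3 * d.
    by rewrite ler_norml; move: ha => /andP[? ?]; apply/andP; split; nra.
  have : `|expR (- a) - 1| * `|sin b| <= 3 * d * enorm (a, b).
    by rewrite ler_pM // (le_trans s1).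
  nra.
lra.
Qed.

(** The pair on the left is the complex product E (c - i s) (p + i q). *)
Lemma enorm_prod (c s E p q : R) : c ^+ 2 + s ^+ 2 = 1 -> 0 <= E ->
  enorm (E * (c * p + s * q), E * (c * q - s * p)) = E * enorm (p, q).
Proof.
move=> cs E0; rewrite /enorm /= -[E in RHS](ger0_norm E0) -sqrtr_sqr.
rewrite -sqrtrM ?sqr_ge0//; congr Num.sqrt.
transitivity ((c ^+ 2 + s ^+ 2) * (E ^+ 2 * (p ^+ 2 + q ^+ 2))); first by ring.
by rewrite cs mul1r.
Qed.

(** The pair on the right is (1 - exp (- z)) (a + i b), the derivative applied to a + i b. The
    hypothesis reads E cos y <= - x, and E^2 >= 1 - 2 x, so the squared modulus 1 - 2 E cos y + E^2
    is at least 2 > (7 / 5)^2. *)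
Lemma fatou_deriv_ge z a b : (F z).1 <= 1 ->
  7 / 5 * enorm (a, b) <=
  enorm (a + expR (- z.1) * (cos z.2 * - a + sin z.2 * - b),
         b + expR (- z.1) * (cos z.2 * - b - sin z.2 * - a)).
Proof.
rewrite /F /= => h; set E := expR (- z.1) in h *.
apply: enorm_ge; rewrite exprMn enorm_sqr /=.
have cs := cos2Dsin2 z.2; set c := cos z.2 in h cs *; set s := sin z.2 in cs *.
have -> : (a + E * (c * - a + s * - b)) ^+ 2 + (b + E * (c * - b - s * - a)) ^+ 2
  = (a ^+ 2 + b ^+ 2) * (1 - 2 * (E * c) + E ^+ 2 * (c ^+ 2 + s ^+ 2)) by ring.
have E2 : 1 + 2 * - z.1 <= E ^+ 2.
  by rewrite expr2 /E -expRD (le_trans _ (expR_ge1Dx _)) //; lra.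
rewrite cs mulr1 mulrC ler_wpM2l ?addr_ge0 ?sqr_ge0//; lra.
Qed.

Lemma fatou_expand z0 : (F z0).1 <= 1 ->
  \forall z \near z0, enorm (z - z0) <= 4 / 5 * enorm (F z - F z0).
Proof.
move=> h0; set E := expR (- z0.1); have E0 : 0 < E := expR_gt0 _.
(* Since 10 d E <= 3 / 20, the remainder lowers the expansion factor from 7 / 5 to 5 / 4, the
   inverse of 4 / 5. *)
pose d := Num.min (1 / 2) (3 / 200 / E).
have d0 : 0 < d by rewrite lt_min !divr_gt0.
have d1 : d <= 1 / 2 by rewrite ge_min lexx.
have dE : d * E <= 3 / 200 by rewrite -ler_pdivlMr // ge_min lexx orbT.
have n1 : \forall z \near z0, `|z.1 - z0.1| < d.
  by have /cvgr_distC_lt := @continuous_fst _ z0; apply.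
have n2 : \forall z \near z0, `|z.2 - z0.2| < d.
  by have /cvgr_distC_lt := @continuous_snd _ z0; apply.
near=> z.
have m1 : `|z.1 - z0.1| < d by near: z.
have m2 : `|z.2 - z0.2| < d by near: z.
pose a := z.1 - z0.1; pose b := z.2 - z0.2.
have -> : z - z0 = (a, b) by [].
pose p := expR (- a) * cos b - 1 + a; pose q := expR (- a) * sin b - b.
have hr : enorm (p, - q) <= 10 * d * enorm (a, b).
  rewrite (_ : enorm (p, - q) = enorm (p, q)); last by rewrite /enorm /= sqrrN.
  by apply: exp_remainder; [rewrite (ltW d0)|exact: ltW|exact: ltW].
have cs := cos2Dsin2 z0.2.
have hd := fatou_deriv_ge a b h0.
have hs : enorm (a + expR (- z0.1) * (cos z0.2 * - a + sin z0.2 * - b),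
         b + expR (- z0.1) * (cos z0.2 * - b - sin z0.2 * - a))
   <= enorm (F z - F z0) + E * enorm (p, - q).
  rewrite -(enorm_prod p (- q) cs (ltW E0)) -[X in _ <= _ + X]enormN.
  apply: le_trans (enormD _ _); rewrite le_eqVlt; apply/orP; left; apply/eqP.
  have e1 : expR (- z.1) = E * expR (- a) by rewrite -expRD /a; congr expR; lra.
  have e2 : cos z.2 = cos z0.2 * cos b - sin z0.2 * sin b.
    by rewrite -cosD /b subrKC.
  have e3 : sin z.2 = sin z0.2 * cos b + cos z0.2 * sin b.
    by rewrite -sinD /b subrKC.
  congr enorm; rewrite /F e1 e2 e3 -/E /p /q.
  by congr (_, _); rewrite /= /a /b; ring.
have N0 := enorm_ge0 (a, b).
have : E * enorm (p, - q) <= 3 / 20 * enorm (a, b).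
  apply: le_trans (_ : E * (10 * d * enorm (a, b)) <= _); first by rewrite ler_pM2l.
  by rewrite !mulrA ler_wpM2r //; lra.
lra.
Unshelve. all: by end_near.
Qed.

End Expansion.
(** * A connected dense set of escaping points *)

Section Basin.
Variable R : realType.
Implicit Types (x y u v a b : R) (z w q : R * R) (j : int) (n : nat).
Local Notation F := (@fatou_plane R).
Local Notation tau := (2 * @pi R).

(** Let s be the supremum of the t at which the bound from 0 holds. The local estimate at s puts s
    itself in this set, and would carry the bound beyond s if s < 1. *)
Lemma lipschitz_of_local (h : R -> R * R) (L : R) :
  (forall s : R, 0 <= s <= 1 ->
    \forall t \near s, 0 <= t <= 1 -> enorm (h t - h s) <= L * `|t - s|) ->
  enorm (h 1 - h 0) <= L.
Proof.
move=> hl; pose A := [set t : R | 0 <= t <= 1 /\ enorm (h t - h 0) <= L * t].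
have A0 : A 0.
  split; first by rewrite lexx ler01.
  by rewrite subrr mulr0 /enorm /= expr0n /= addr0 sqrtr0.
have supA : has_sup A.
  by split; [exists 0|exists 1 => t [/andP[]]].
set s := sup A.
have s0 : 0 <= s by apply: ub_le_sup => //; case: supA.
have s1 : s <= 1 by apply: ge_sup => [|t [/andP[]]//]; exists 0.
have /nbhs_ballP[e /= e0 he] : \forall t \near s,
    0 <= t <= 1 -> enorm (h t - h s) <= L * `|t - s|.
  by apply: hl; rewrite s0.
have tri a b c : enorm (h a - h c) <= enorm (h a - h b) + enorm (h b - h c).
  by rewrite (le_trans _ (enormD _ _)) // addrA subrK.
have As : A s.
  split; first by rewrite s0.
  have [t [t01 ht]] := sup_adherent e0 supA; rewrite -/s => st.
  have ts : t <= s by apply: ub_le_sup; [case: supA|].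
  apply: le_trans (tri s t 0) _.
  have := he t _ t01; rewrite enorm_dist distrC ger0_norm ?subr_ge0// => hts.
  have : enorm (h s - h t) <= L * (s - t).
    by apply: hts; rewrite /ball/= ger0_norm ?subr_ge0//; lra.
  lra.
have [s1'|s1'] := ltP s 1; last first.
  have e1 : s = 1 by apply/eqP; rewrite eq_le s1.
  by case: As => _; rewrite e1 mulr1.
exfalso; pose t := Num.min 1 (s + e / 2).
have ts : s < t by rewrite lt_min s1' ltrDl divr_gt0.
have t1 : t <= 1 by rewrite ge_min lexx.
have te : t <= s + e / 2 by rewrite ge_min lexx orbT.
suff : A t by move/(ub_le_sup (proj2 supA)); rewrite -/s; lra.
have t01 : 0 <= t <= 1 by apply/andP; split; lra.
split=> //; apply: le_trans (tri t s 0) _.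
have := he t _ t01; rewrite ger0_norm; last by lra.
have := As.2; move=> h1 h2.
have : enorm (h t - h s) <= L * (t - s).
  by apply: h2; rewrite /ball/= distrC ger0_norm; lra.
lra.
Qed.

Definition reaches z := exists n, 1 <= (iter n F z).1 \/ on_line (iter n F z).

Lemma reachesF z : reaches (F z) -> reaches z.
Proof. by move=> [n]; rewrite -iterSr => h; exists n.+1. Qed.

Lemma reaches_escapes z : reaches z -> escapes z.
Proof.
move=> [n]; elim: n z => [|n IH] z; last by rewrite iterSr => /IH/escapesF.
by case=> [/right_escapes|/line_escapes].
Qed.

(** The segment from [w] to [q] stays in Re <= 1, where local expansion of [F] makes the branch
    locally Lipschitz with constant 4 / 5 along it. *)
Lemma branch_segment_le j w q : w.1 <= 1 -> q.1 <= 1 ->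
  enorm (branch j q - branch j w) <= 4 / 5 * enorm (q - w).
Proof.
move=> w1 q1; pose c (t : R) := w + t *: (q - w).
have c1 t : 0 <= t <= 1 -> (c t).1 <= 1.
  have -> : (c t).1 = w.1 + t * (q.1 - w.1) by [].
  by move=> /andP[? ?]; nra.
have cc (t : R) : {for t, continuous c}.
  apply: cvgD; first exact: cvg_cst.
  by apply: cvgZr_tmp; exact: cvg_id.
have e0 : branch j w = branch j (c 0) by rewrite /c scale0r addr0.
have e1 : branch j q = branch j (c 1) by rewrite /c scale1r subrKC.
rewrite e0 e1; apply: (@lipschitz_of_local (branch j \o c)) => s s01.
have cs2 : (c s).1 < 2 by have := c1 s s01; lra.
have [_ Fs] := branchP j cs2.
have := @fatou_expand R (branch j (c s)); rewrite Fs => /(_ (c1 s s01)) ex.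
have cb : {for s, continuous (branch j \o c)}.
  by apply: continuous_comp; [exact: cc|exact: branch_continuous].
have {}ex := cb _ ex; near=> t => t01.
have : enorm (branch j (c t) - branch j (c s)) <=
  4 / 5 * enorm (F (branch j (c t)) - c s) by near: t.
move/le_trans; apply.
have [_ ->] : strip j (branch j (c t)) /\ F (branch j (c t)) = c t.
  by apply: branchP; have := c1 t t01; lra.
have -> : c t - c s = (t - s) *: (q - w).
  by rewrite /c scalerBl opprD addrACA subrr add0r.
by rewrite enormZ; lra.
Unshelve. all: by end_near.
Qed.

(* The segment from [F z] to a nearby point is cut where it meets [z.1 = 1],
   which is already in the set, so that the branch contracts along all of it. *)
Lemma reaches_near n z : exists2 q, reaches q & enorm (z - q) <= tau * (4 / 5) ^+ n.
Proof.
have tau0 : 0 < tau by rewrite mulr_gt0 ?pi_gt0.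
elim: n z => [|n IH] z.
  rewrite expr0 mulr1; have [lz|[j]] := line_or_strip z.
    exists z; first by exists 0%N; right.
    by rewrite subrr /enorm /= expr0n /= addr0 sqrtr0 ltW.
  rewrite /strip => /andP[h1 h2]; exists (z.1, j%:~R * tau).
    by exists 0%N; right; exists j.
  by apply: le_trans (enorm_le_sum _) _; rewrite /= subrr normr0 add0r ger0_norm; lra.
have bd0 : 0 <= tau * (4 / 5) ^+ n.+1 by rewrite mulr_ge0 ?ltW// exprn_ge0.
have self : reaches z -> exists2 q, reaches q & enorm (z - q) <= tau * (4 / 5) ^+ n.+1.
  by exists z => //; rewrite subrr /enorm /= expr0n /= addr0 sqrtr0.
have [F1|F1] := leP 1 (F z).1; first by apply: self; exists 1%N; left.
have [lz|[j sz]] := line_or_strip z; first by apply: self; exists 0%N; right.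
have [q [q1 rq hq]] : exists q,
    [/\ q.1 <= 1, reaches q & enorm (F z - q) <= tau * (4 / 5) ^+ n].
  have [q rq hq] := IH (F z); have [q1|q1] := leP q.1 1; first by exists q.
  pose t := (1 - (F z).1) / (q.1 - (F z).1).
  have d0 : 0 < q.1 - (F z).1 by lra.
  have t0 : 0 <= t by rewrite divr_ge0 //; lra.
  have t1 : t <= 1 by rewrite ler_pdivrMr //; lra.
  exists (F z + t *: (q - F z)).
  have e : (F z + t *: (q - F z)).1 = 1.
    rewrite -[LHS]/((F z).1 + t * (q.1 - (F z).1)) /t divfK ?gt_eqF//; lra.
  split; first by rewrite e.
    by exists 0%N; left; rewrite /iter e.
  rewrite opprD addrA subrr add0r enormN enormZ ger0_norm // enorm_dist.
  by rewrite (le_trans _ hq) // ler_piMl ?enorm_ge0.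
exists (branch j q).
  by apply: reachesF; have [|_ ->] := @branchP R j q; first lra.
have -> : z = branch j (F z) by rewrite branchK //; lra.
rewrite enorm_dist; apply: le_trans (branch_segment_le _ _ _) _ => //; first by lra.
rewrite enorm_dist exprS; lra.
Qed.


(** The bound [w.1 < 2] keeps the connecting set where the branches are continuous, so it can be
    lifted as a whole; the endpoint [q] attaches it to the half-plane Re >= 1. *)
Definition linked z := exists C, [/\ connected C, C z,
  C `<=` [set w | reaches w /\ w.1 < 2] & exists2 q, C q & 1 <= q.1].

Lemma linked_trans (C : set (R * R)) z w : connected C -> C z -> C w ->
  C `<=` [set w | reaches w /\ w.1 < 2] -> linked w -> linked z.
Proof.
move=> Cc Cz Cw Cs [D [Dc Dw Ds [q Dq q1]]]; exists (C `|` D); split.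
- by apply: connectedU => //; exists w.
- by left.
- by move=> x [/Cs|/Ds].
- by exists q => //; right.
Qed.

Lemma linked_segment (c : R -> R * R) : continuous c ->
  (forall t, 0 <= t <= 1 -> reaches (c t) /\ (c t).1 < 2) ->
  linked (c 1) -> linked (c 0).
Proof.
move=> cc ch; apply: (@linked_trans (c @` `[0, 1])).
- apply: connected_continuous_connected; first exact: segment_connected.
  exact: continuous_subspaceT.
- by exists 0 => //=; rewrite in_itv/= lexx ler01.
- by exists 1 => //=; rewrite in_itv/= lexx ler01.
- by move=> _ [t /= t01 <-]; apply: ch; rewrite in_itv/= in t01.
Qed.

Lemma linked_right z : 1 <= z.1 < 2 -> linked z.
Proof.
move=> /andP[z1 z2]; exists [set z]; split => //; first exact: connected1.
  by move=> _ ->; split => //; exists 0%N; left.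
by exists z.
Qed.

Lemma linked_line z : on_line z -> z.1 < 2 -> linked z.
Proof.
move=> lz z2; have [z1|z1] := leP 1 z.1; first by apply: linked_right; rewrite z1.
pose c (t : R) := (z.1 + t * (1 - z.1), z.2).
have -> : z = c 0 by rewrite /c mul0r addr0 -surjective_pairing.
apply: linked_segment; last by apply: linked_right; rewrite /c /=; apply/andP; split; lra.
  move=> t; apply: (@continuous_pair R R R (fun t => z.1 + t * (1 - z.1)) (fun=> z.2));
    last exact: cvg_cst.
  apply: cvgD; first exact: cvg_cst.
  by apply: cvgM; [exact: cvg_id|exact: cvg_cst].
move=> t /andP[t0 t1]; split; last by rewrite /=; nra.
by exists 0%N; right; case: lz => j e; exists j.
Qed.

Lemma cos_le_segment b t : `|b| <= pi -> 0 <= t <= 1 -> cos b <= cos (t * b).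
Proof.
wlog b0 : b / 0 <= b.
  move=> h; have [/h//|b0] := leP 0 b.
  by have := h (- b); rewrite normrN mulrN !cosN; apply; lra.
rewrite ger0_norm // => bp /andP[t0 t1].
rewrite leNgt ltr_cos ?in_itv /= ?b0 ?bp ?mulr_ge0 //=.
  by rewrite -leNgt ler_piMl.
by rewrite (le_trans _ bp) // ler_piMl.
Qed.

(** Move vertically to the nearest line: cos y does not fall below its initial value, so Re F stays
    at least 1 on the way. From there follow the line. *)
Lemma linked_preright z : 1 <= (F z).1 -> z.1 < 2 -> linked z.
Proof.
move=> F1 z2; have [lz|[j]] := line_or_strip z; first exact: linked_line.
rewrite /strip => /andP[h1 h2].
have [k bk] : exists k : int, `|z.2 - k%:~R * tau| <= pi.
  have [h|h] := leP (z.2 - j%:~R * tau) pi.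
    by exists j; rewrite ger0_norm; lra.
  by exists (j + 1); rewrite intrD ler_norml; apply/andP; split; lra.
set b := z.2 - _ in bk.
pose c (t : R) := (z.1, (1 - t) * b + k%:~R * tau).
have -> : z = c 0 by rewrite /c subr0 mul1r /b subrK -surjective_pairing.
apply: linked_segment; last 1 first.
  by apply: linked_line; rewrite // /c subrr mul0r add0r; exists k.
  move=> t; apply: (@continuous_pair R R R (fun=> z.1)
      (fun t => (1 - t) * b + k%:~R * tau)); first exact: cvg_cst.
  apply: cvgD; last exact: cvg_cst.
  apply: cvgM; last exact: cvg_cst.
  by apply: cvgB; [exact: cvg_cst|exact: cvg_id].
move=> t /andP[t0 t1]; split => //.
exists 1%N; left; apply: le_trans F1 _; rewrite /F /c /= lerD2l ler_pM2l ?expR_gt0//.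
rewrite cos_shift -[in cos z.2](subrK (k%:~R * tau) z.2) cos_shift.
by apply: cos_le_segment => //; apply/andP; split; lra.
Qed.

(** Induction on the time of arrival. The set linking [F z] to Re >= 1 is lifted by the branch of
    the strip of [z]; it then ends at a preimage of a point with Re >= 1, where [linked_preright]
    applies. *)
Lemma linked_reaches z : reaches z -> z.1 < 2 -> linked z.
Proof.
move=> [n]; elim: n z => [|n IH] z.
  by move=> [h1 h2|]; [apply: linked_right; apply/andP|exact: linked_line].
rewrite iterSr => hn z2; have [|F1] := leP 1 (F z).1.
  by move=> h; apply: linked_preright.
have [lz|[j sz]] := line_or_strip z; first exact: linked_line.
have [|C [Cc Cz Cs [q Cq q1]]] := IH _ hn; first lra.
have F2 : (F z).1 < 2 by lra.
have Cs' : C `<=` [set w | w.1 < 2] by move=> w /Cs[].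
(* On Re >= 1 the map increases the real part, so a preimage with Re >= 2 would have its image there
   too. *)
have br w : w.1 < 2 -> (branch j w).1 < 2.
  move=> w2; have [_ e] := branchP j w2; rewrite ltNge; apply/negP => h.
  have : 1 <= (branch j w).1 by lra.
  by move=> /fatou_re_right; rewrite e; lra.
apply: (@linked_trans (branch j @` C) _ (branch j q)).
- apply: connected_continuous_connected => //.
  by apply: continuous_in_subspaceT => w; rewrite inE => /Cs'; exact: branch_continuous.
- by exists (F z) => //; rewrite branchK.
- by exists q.
- move=> _ [w /[dup] /Cs'/= w2 /Cs[rw _] <-]; split; last exact: br.
  by apply: reachesF; have [_ ->] := branchP j w2.
- have q2 : q.1 < 2 by apply: Cs'.
  by apply: linked_preright; [have [_ ->] := branchP j q2|exact: br].
Qed.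

Lemma connected_from (T : topologicalType) (A : set T) c :
  (forall p : T, A p -> exists C, [/\ connected C, C p, C c & C `<=` A]) -> connected A.
Proof.
move=> h; pose I := [set C | [/\ connected C, C c & C `<=` A]].
have -> : A = \bigcup_(C in I) C.
  apply/seteqP; split => [z /h[C [Cc Cz C0 CA]]|z [C [_ _ CA] Cz]]; last exact: CA.
  by exists C.
by apply: bigcup_connected => [|C []//]; exists c => C [].
Qed.

Lemma right_half_plane_connected : connected [set z : R * R | 1 <= z.1].
Proof.
apply: (@connected_from (R * R)%type _ (1, 0)) => z /= z1.
pose c (t : R) := (1 + t * (z.1 - 1), t * z.2).
exists (c @` `[0, 1]); split.
- apply: connected_continuous_connected; first exact: segment_connected.
  apply: continuous_subspaceT => t.
  apply: (@continuous_pair R R R (fun t => 1 + t * (z.1 - 1)) (fun t => t * z.2)).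
    by apply: cvgD; [exact: cvg_cst|apply: cvgM; [exact: cvg_id|exact: cvg_cst]].
  by apply: cvgM; [exact: cvg_id|exact: cvg_cst].
- exists 1 => /=; first by rewrite in_itv/= lexx ler01.
  by rewrite /c !mul1r subrKC -surjective_pairing.
- exists 0 => /=; first by rewrite in_itv/= lexx ler01.
  by rewrite /c !mul0r addr0.
- by move=> _ [t /= + <-]; rewrite in_itv /= => /andP[t0 t1]; nra.
Qed.

Lemma reaches_connected : connected (reaches : set (R * R)).
Proof.
pose P := [set z : R * R | 1 <= z.1].
have Pr : P `<=` reaches by move=> w w1; exists 0%N; left.
apply: (@connected_from (R * R)%type _ (1, 0)) => z rz.
have [z2|z2] := ltP z.1 2; last first.
  exists P; split => //; [exact: right_half_plane_connected| |by rewrite /P/=].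
  by rewrite /P/=; lra.
have [C [Cc Cz Cs [q Cq q1]]] := linked_reaches rz z2.
exists (C `|` P); split; [|by left|by right; rewrite /P/=|].
  by apply: connectedU => //; [exists q|exact: right_half_plane_connected].
by move=> w [/Cs[]|/Pr].
Qed.

Lemma reaches_dense : closure (reaches : set (R * R)) = setT.
Proof.
apply/seteqP; split => // z _ B /nbhs_ballP[e /= e0 hB].
have tau0 : 0 < tau by rewrite mulr_gt0 ?pi_gt0.
have [n hn] : exists n, (4 / 5) ^+ n < e / tau :> R.
  have c : `|4 / 5 : R| < 1 by rewrite ger0_norm; lra.
  have [n _ hn] : \forall n \near \oo, (4 / 5 : R) ^+ n < e / tau.
    by have /cvgr_lt := cvg_expr c; apply; rewrite divr_gt0.
  by exists n; apply: hn => /=.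
have [q rq hq] := reaches_near n z; exists q; split => //; apply: hB.
have {}hq : enorm (z - q) < e.
  by apply: le_lt_trans hq _; rewrite mulrC -ltr_pdivlMr.
split; rewrite /ball /=; apply: le_lt_trans hq.
  exact: (abs1_le_enorm (z - q)).
exact: (abs2_le_enorm (z - q)).
Qed.

End Basin.
(** * Contractible sets are simply connected *)

Section Contractible.
Variables (R : realType) (V : normedModType R).
Implicit Types (G : set V) (D : R * V -> V) (s t : R) (x y c : V).

(** Composing with this retraction makes maps on [0, 1] continuous on the whole line and lets
    successive stages be written in one formula. *)
Definition clamp (t : R) : R := Num.max 0 (Num.min 1 t).

Lemma clamp01 t : 0 <= clamp t <= 1.
Proof. by rewrite /clamp le_max lexx /= ge_max ler01 ge_min lexx. Qed.

Lemma clamp_id t : 0 <= t <= 1 -> clamp t = t.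
Proof. by move=> /andP[t0 t1]; rewrite /clamp min_r // max_r. Qed.

Lemma clamp_le0 t : t <= 0 -> clamp t = 0.
Proof. by move=> t0; rewrite /clamp min_r ?max_l //; lra. Qed.

Lemma clamp_ge1 t : 1 <= t -> clamp t = 1.
Proof. by move=> t1; rewrite /clamp min_l // max_r. Qed.

Lemma continuous_clamp_comp (T : topologicalType) (f : T -> R) (t : T) :
  {for t, continuous f} -> {for t, continuous (fun u => clamp (f u))}.
Proof.
move=> fc; apply: (@continuous_max R T (fun=> 0) (fun u => Num.min 1 (f u))).
  exact: cvg_cst.
by apply: (@continuous_min R T (fun=> 1) f) => //; exact: cvg_cst.
Qed.

Lemma continuous_clamp : continuous clamp.
Proof. by move=> t; apply: (@continuous_clamp_comp R id); exact: cvg_id. Qed.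

Lemma within_clamp (T : topologicalType) (gamma : R -> T) :
  {within `[0, 1], continuous gamma} -> continuous (gamma \o clamp).
Proof.
move=> /subspace_continuousP gc t.
apply: (@cvg_comp _ _ _ clamp gamma (nbhs t)
  (within `[0, 1] (nbhs (clamp t)))); last first.
  by apply: gc; rewrite /= in_itv/= clamp01.
move=> A hA.
have h : \forall u \near t, `[0, 1]%classic (clamp u) -> A (clamp u).
  exact: (@continuous_clamp t _ hA).
apply: filterS h => u; apply.
by rewrite /= in_itv/= clamp01.
Qed.

(** The deformation may move the base point of a loop, so [contractible_loop] has to account for the
    track of that point. *)
Definition contracts G c D :=
  [/\ forall s z, 0 <= s <= 1 -> G z -> {for (s, z), continuous D},
      forall s z, 0 <= s <= 1 -> G z -> G (D (s, z)),
      forall z, G z -> D (0, z) = z &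
      forall z, G z -> D (1, z) = c].

Section Contraction.
Variables (G : set V) (c : V) (D : R * V -> V).
Hypothesis GD : contracts G c D.

Lemma contraction_continuous (T : topologicalType) (f : T -> R) (g : T -> V) (t : T) :
  {for t, continuous f} -> {for t, continuous g} -> 0 <= f t <= 1 -> G (g t) ->
  {for t, continuous (fun u => D (f u, g u))}.
Proof.
case: GD => Dc _ _ _ fc gc ft gt.
apply: (@continuous_comp T (R * V)%type V (fun u => (f u, g u)) D).
  exact: continuous_pair.
exact: Dc.
Qed.

(* At each time one of the two moving terms equals [c], so the sum minus [c] is
   the concatenation of two paths without any case distinction. *)
Lemma contractible_path x y :
  G x -> G y -> exists gamma : R -> V, path_in G x y gamma.
Proof.
move=> Gx Gy; have [Dc DG D0 D1] := GD.
exists (fun t => D (clamp (2 * t), x) + D (clamp (2 - 2 * t), y) - c); split.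
- apply: continuous_subspaceT => t.
  have c2 : {for t, continuous (fun t => 2 * t : R)}.
    by apply: cvgM; [exact: cvg_cst|exact: cvg_id].
  have c2' : {for t, continuous (fun t => 2 - 2 * t : R)}.
    by apply: cvgB; [exact: cvg_cst|exact: c2].
  have d1 : {for t, continuous (fun t => D (clamp (2 * t), x))}.
    apply: (@contraction_continuous R (fun t => clamp (2 * t)) (fun=> x)) => //.
    - exact: continuous_clamp_comp.
    - exact: cvg_cst.
    - exact: clamp01.
  have d2 : {for t, continuous (fun t => D (clamp (2 - 2 * t), y))}.
    apply: (@contraction_continuous R (fun t => clamp (2 - 2 * t)) (fun=> y)) => //.
    - exact: continuous_clamp_comp.
    - exact: cvg_cst.
    - exact: clamp01.
  by apply: cvgB; [apply: cvgD; [exact: d1|exact: d2]|exact: cvg_cst].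
- move=> _ [t _ <-]; have [t2|t2] := leP t (1 / 2).
    have -> : clamp (2 - 2 * t) = 1 by apply: clamp_ge1; lra.
    by rewrite D1 // addrK; apply: DG => //; exact: clamp01.
  have -> : clamp (2 * t) = 1 by apply: clamp_ge1; lra.
  by rewrite D1 // addrC addKr; apply: DG => //; exact: clamp01.
- by rewrite mulr0 subr0 clamp_le0 // clamp_ge1 ?ler1n // D0 // D1 // addrK.
- rewrite mulr1 subrr [clamp 0]clamp_le0 // clamp_ge1 ?ler1n // D0 // D1 //.
  by rewrite addrC addKr.
Qed.

Lemma contractible_loop x (gamma : R -> V) :
  path_in G x x gamma -> null_homotopic G x gamma.
Proof.
move=> [/within_clamp gc gG g0 g1]; have [Dc DG D0 D1] := GD.
pose g := gamma \o clamp.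
have gg t : 0 <= t <= 1 -> g t = gamma t by move=> h; rewrite /g /= clamp_id.
have Gg t : G (g t) by apply: gG; exists (clamp t) => //=; rewrite in_itv/= clamp01.
have Gx : G x by rewrite -g0 -gg ?lexx ?ler01.
(* [k] vanishes at both ends of the loop and is 1 on its middle third; capping the deformation times
   by [k] keeps the ends at [x]. [b] gradually reparametrizes the loop so that it is run through on
   the middle third. *)
pose k t := clamp (Num.min (3 * t) (3 - 3 * t)).
pose b s t := (1 - clamp (3 * s)) * t + clamp (3 * s) * clamp (3 * t - 1).
pose a1 s t := Num.min (clamp (3 * s - 1)) (k t).
pose a2 s t := Num.min (1 - clamp (3 * s - 2)) (k t).
have k01 t : 0 <= k t <= 1 by exact: clamp01.
have a101 s t : 0 <= a1 s t <= 1.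
  have /andP[? ?] := k01 t; have /andP[? ?] := clamp01 (3 * s - 1).
  by rewrite le_min ge_min; apply/andP; split; [apply/andP; split|apply/orP; left].
have a201 s t : 0 <= a2 s t <= 1.
  have /andP[? ?] := k01 t; have /andP[? ?] := clamp01 (3 * s - 2).
  by rewrite le_min ge_min; apply/andP; split; [apply/andP; split; lra|apply/orP; right].
(* For [s <= 2 / 3] the last two terms cancel, for [2 / 3 <= s] the outer ones. The
   three stages: reparametrize [gamma], move it to [c] along the track of [x], then
   retract that track. *)
pose H (p : R * R) := D (a1 p.1 p.2, g (b p.1 p.2)) + D (a2 p.1 p.2, x) - D (k p.2, x).
have early s t : s <= 2 / 3 -> H (s, t) = D (a1 s t, g (b s t)).
  move=> s3; rewrite /H /= /a2 [clamp (3 * s - 2)]clamp_le0; last by lra.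
  by rewrite subr0 min_r ?addrK //; case/andP: (k01 t).
have gx t : t <= 0 \/ 1 <= t -> g t = x.
  by rewrite /g /= => -[/clamp_le0|/clamp_ge1] ->.
have late s t : 2 / 3 <= s -> H (s, t) = D (a2 s t, x).
  move=> s3; rewrite /H /= /a1 /b [clamp (3 * s - 1)]clamp_ge1; last by lra.
  rewrite [clamp (3 * s)]clamp_ge1; last by lra.
  rewrite subrr mul0r mul1r add0r min_r; last by case/andP: (k01 t).
  have -> : D (k t, g (clamp (3 * t - 1))) = D (k t, x); last by rewrite addrC addKr.
  have [t1|t1] := leP t (1 / 3); first by rewrite gx //; left; rewrite clamp_le0 //; lra.
  have [t2|t2] := leP (2 / 3) t; first by rewrite gx //; right; rewrite clamp_ge1 //; lra.
  by rewrite /k clamp_ge1 ?D1 // le_min; apply/andP; split; lra.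
exists H; split.
- apply: continuous_subspaceT => -[s t].
  have c1 (m : R) : {for (s, t), continuous (fun p : R * R => m * p.1)}.
    by apply: cvgM; [exact: cvg_cst|exact: cvg_fst].
  have c2 (m : R) : {for (s, t), continuous (fun p : R * R => m * p.2)}.
    by apply: cvgM; [exact: cvg_cst|exact: cvg_snd].
  have ck : {for (s, t), continuous (fun p : R * R => k p.2)}.
    apply: continuous_clamp_comp.
    apply: (@continuous_min R (R * R)%type (fun p => 3 * p.2) (fun p => 3 - 3 * p.2)).
      exact: c2.
    by apply: cvgB; [exact: cvg_cst|exact: c2].
  have cl (f : R * R -> R) (m : R) : {for (s, t), continuous f} ->
      {for (s, t), continuous (fun p => clamp (f p - m))}.
    by move=> cf; apply: continuous_clamp_comp; apply: cvgB; [exact: cf|exact: cvg_cst].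
  have d1 : {for (s, t), continuous (fun p : R * R => D (a1 p.1 p.2, g (b p.1 p.2)))}.
    apply: (@contraction_continuous (R * R)%type (fun p => a1 p.1 p.2)
      (fun p => g (b p.1 p.2))) => //.
    - apply: (@continuous_min R (R * R)%type (fun p => clamp (3 * p.1 - 1))
        (fun p => k p.2)) => //.
      by apply: cl; exact: c1.
    - apply: (@continuous_comp _ _ _ (fun p : R * R => b p.1 p.2) g); last exact: gc.
      have b1 : {for (s, t), continuous (fun p : R * R => clamp (3 * p.1))}.
        by apply: continuous_clamp_comp; exact: c1.
      have b2 : {for (s, t), continuous (fun p : R * R => clamp (3 * p.2 - 1))}.
        by apply: cl; exact: c2.
      have b3 : {for (s, t), continuous (fun p : R * R => 1 - clamp (3 * p.1))}.
        by apply: cvgB; [exact: cvg_cst|exact: b1].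
      have b4 : {for (s, t), continuous (fun p : R * R => p.2)} by exact: cvg_snd.
      by apply: cvgD; apply: cvgM; [exact: b3|exact: b4|exact: b1|exact: b2].
  have d2 : {for (s, t), continuous (fun p : R * R => D (a2 p.1 p.2, x))}.
    apply: (@contraction_continuous (R * R)%type (fun p => a2 p.1 p.2) (fun=> x)) => //.
    - apply: (@continuous_min R (R * R)%type (fun p => 1 - clamp (3 * p.1 - 2))
        (fun p => k p.2)) => //.
      have b1 : {for (s, t), continuous (fun p : R * R => clamp (3 * p.1 - 2))}.
        by apply: cl; exact: c1.
      by apply: cvgB; [exact: cvg_cst|exact: b1].
    - exact: cvg_cst.
  have d3 : {for (s, t), continuous (fun p : R * R => D (k p.2, x))}.
    apply: (@contraction_continuous (R * R)%type (fun p => k p.2) (fun=> x)) => //.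
    exact: cvg_cst.
  by apply: cvgB; [apply: cvgD; [exact: d1|exact: d2]|exact: d3].
- move=> _ [[s t] _ <-]; have [s3|s3] := leP s (2 / 3).
    by rewrite early //; exact: DG.
  by rewrite late ?ltW //; exact: DG.
- move=> t t01; rewrite early; last by lra.
  rewrite /a1 /b clamp_le0; last by lra.
  rewrite mulr0 [clamp 0]clamp_id ?lexx ?ler01// subr0 mul1r mul0r addr0 min_l.
    by rewrite D0 // gg.
  by case/andP: (k01 t).
- move=> t t01; rewrite late; last by lra.
  rewrite /a2 clamp_ge1; last by lra.
  rewrite subrr min_l; first exact: D0.
  by case/andP: (k01 t).
- move=> s s01.
  have k0 : k 0 = 0 by rewrite /k clamp_le0 // ge_min mulr0 lexx.
  have k1 : k 1 = 0 by rewrite /k clamp_le0 // ge_min mulr1 subrr lexx orbT.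
  have a1k t : k t = 0 -> a1 s t = 0.
    by rewrite /a1 => ->; rewrite min_r //; case/andP: (clamp01 (3 * s - 1)).
  have a2k t : k t = 0 -> a2 s t = 0.
    by rewrite /a2 => ->; rewrite min_r //; case/andP: (clamp01 (3 * s - 2)); lra.
  split; rewrite /H /= a1k // a2k // ?k0 ?k1 !D0 // addrK gx //.
    by left; rewrite /b mulr0 add0r mulr0 sub0r [clamp (- 1)]clamp_le0 ?mulr0 //; lra.
  by right; rewrite /b [clamp (3 * 1 - 1)]clamp_ge1 ?mulr1 ?subrK //; lra.
Qed.

Lemma contractible_simply_connected : simply_connected R G.
Proof.
by split; [move=> *; exact: contractible_path|move=> *; exact: contractible_loop].
Qed.

End Contraction.

End Contractible.

(** The image of a loop is compact, hence contained in a single member of the increasing open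
    family, where it can be contracted. *)
Lemma simply_connected_bigcup (R : realType) (T : topologicalType) (G : nat -> set T) :
  (forall n, open (G n)) -> (forall n, G n `<=` G n.+1) ->
  (forall n, simply_connected R (G n)) -> simply_connected R (\bigcup_n G n).
Proof.
move=> Go Gs Gsc.
have Gle m n : (m <= n)%N -> G m `<=` G n.
  move=> /subnK <-; elim: (n - m)%N => [|i IH] //=.
  by rewrite addSn; apply: subset_trans IH (Gs _).
have up n : G n `<=` \bigcup_n G n by move=> z Gz; exists n.
split=> [x y [m _ Gx] [n _ Gy]|x gamma [gc gG g0 g1]].
  have [||gamma [gc gG g0 g1]] := (Gsc (maxn m n)).1 x y.
  - by apply: Gle Gx; exact: leq_maxl.
  - by apply: Gle Gy; exact: leq_maxr.
  by exists gamma; split => //; apply: subset_trans gG (up _).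
have : compact (gamma @` `[0, 1]).
  by apply: continuous_compact => //; exact: segment_compact.
rewrite compact_near_coveringP => /(_ _ \oo (fun n z => G n z)) cov.
have [N _ hN] : \forall n \near \oo, gamma @` `[0, 1] `<=` G n.
  apply: cov => z /gG[m _ Gz]; exists (G m, [set n | (m <= n)%N]) => /=.
    by split; [exact: open_nbhs_nbhs|exists m].
  by move=> [z' n] [/= Gz' mn]; apply: Gle mn _ Gz'.
have gN : path_in (G N) x x gamma.
  by split => //; apply: hN => /=.
have [H [Hc HG H0 H1 Hx]] := (Gsc N).2 _ _ gN.
by exists H; split => //; apply: subset_trans HG (up _).
Qed.
(** * The domains of the web *)

Section Domains.
Variable R : realType.
Implicit Types (x y u v : R) (z w q : R * R) (l m n : nat).
Local Notation F := (@fatou_plane R).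
Local Notation tau := (2 * @pi R).

(* Fast enough for [fatou_box], and slow enough for [fatou_far_left]. *)
Fixpoint radius n : nat :=
  if n is n'.+1 then (Num.trunc (expR (radius n')%:R : R) + radius n' + 2)%N else 3.

Arguments radius : simpl never.

Lemma radiusS n :
  radius n.+1 = (Num.trunc (expR (radius n)%:R : R) + radius n + 2)%N.
Proof. by []. Qed.

Local Notation a n := ((radius n)%:R : R).

Lemma radius_ge n : (n + 3 <= radius n)%N.
Proof. by elim: n => // n IH; rewrite radiusS; lia. Qed.

Lemma radius_ge3 n : 3 <= a n.
Proof. by rewrite (ler_nat R 3); apply: leq_trans (radius_ge n); rewrite leq_addl. Qed.

Lemma radiusS_ge n : a n + 1 + expR (a n) <= a n.+1.
Proof.
rewrite radiusS !natrD; have := @truncnS_gt R (expR (a n)); rewrite -natr1; lra.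
Qed.

Lemma radiusS_le n : a n.+1 <= 3 * expR (a n).
Proof.
rewrite radiusS !natrD; have /andP[+ _] := truncn_itv (expR_ge0 (a n)).
have := expR_ge1Dx (a n); have := radius_ge3 n; lra.
Qed.

Lemma tau_ge4 : 4 <= tau.
Proof. by have := pi_ge2 R; lra. Qed.

(** The radius is a natural number, so the top and bottom edges are lines; the right edge lies in Re
    >= 3. The zone is unbounded to the left. *)
Definition zone n : set (R * R) := [set z | z.1 < a n /\ `|z.2| < tau * a n].

Definition box n : set (R * R) := [set z | zone n z /\ - a n < z.1].

Fixpoint core l n : set (R * R) :=
  if l is l'.+1 then [set z | zone n z /\ core l' n.+1 (F z)] else box n.

Definition web_domain n := \bigcup_l core l n.

(** On the box exp (- x) < exp (a n), so [F] moves each coordinate by at most 1 + exp (a n), which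
    the growth of the radius absorbs. *)
Lemma fatou_box n z : box n z -> box n.+1 (F z).
Proof.
move=> [[z1 z2] z3]; have h := radiusS_ge n; have a3 := radius_ge3 n; have t4 := tau_ge4.
have E0 := expR_gt0 (- z.1); have E1 : expR (- z.1) < expR (a n) by rewrite ltr_expR; lra.
have c1 := cos_le1 z.2; have c2 := cos_geN1 z.2; have s1 := sin_max z.2.
have ha0 := expR_gt0 (a n).
have e1 : - expR (a n) <= expR (- z.1) * cos z.2 by nra.
have e2 : expR (- z.1) * cos z.2 <= expR (a n) by nra.
have e3 : `|expR (- z.1) * sin z.2| <= expR (a n).
  by rewrite normrM (ger0_norm (ltW E0)); nra.
split; [split|]; rewrite /fatou_plane /=; try lra.
apply: le_lt_trans (ler_normB _ _) _.
have : tau * (a n + 1 + expR (a n)) <= tau * a n.+1 by rewrite ler_pM2l //; lra.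
nra.
Qed.

Lemma zone_sub n : zone n `<=` zone n.+1.
Proof.
move=> z [z1 z2]; have h := radiusS_ge n; have ha0 := expR_gt0 (a n).
have : tau * a n <= tau * a n.+1 by rewrite ler_pM2l; [lra|have := tau_ge4; lra].
by split; lra.
Qed.

Lemma box_sub n : box n `<=` box n.+1.
Proof.
move=> z [/zone_sub z1 z2]; split => //.
by have h := radiusS_ge n; have ha0 := expR_gt0 (a n); lra.
Qed.

Lemma core_zone l n : core l n `<=` zone n.
Proof. by case: l => [|l] z []. Qed.

Lemma coreS l n : core l n `<=` core l.+1 n.
Proof.
elim: l n => [|l IH] n z; first by move=> h; split; [case: h|exact: fatou_box].
by move=> [h1 h2]; split => //; exact: IH.
Qed.

Lemma core_le k l n : (k <= l)%N -> core k n `<=` core l n.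
Proof.
move=> /subnK <-; elim: (l - k)%N => [|i IH] //.
by rewrite addSn; apply: subset_trans IH (@coreS _ _).
Qed.

Lemma core_sub l n : core l n `<=` core l n.+1.
Proof.
elim: l n => [|l IH] n; first exact: box_sub.
by move=> z [/zone_sub h1 h2]; split => //; exact: IH.
Qed.

Lemma open_zone n : open (zone n).
Proof.
have -> : zone n = (fst @^-1` [set x | x < a n])
    `&` ((fun z => `|z.2|) @^-1` [set y | y < tau * a n]).
  by [].
apply: openI; apply: open_comp; try exact: open_lt.
  by move=> z _; exact: continuous_fst.
by move=> z _; apply: cvg_norm; exact: continuous_snd.
Qed.

Lemma open_core l n : open (core l n).
Proof.
elim: l n => [|l IH] n /=.
  have -> : box n = zone n `&` (fst @^-1` [set x | - a n < x]) by [].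
  apply: openI; first exact: open_zone.
  by apply: open_comp; [move=> z _; exact: continuous_fst|exact: open_gt].
have -> : [set z | zone n z /\ core l n.+1 (F z)]
    = zone n `&` (F @^-1` core l n.+1) by [].
apply: openI; first exact: open_zone.
by apply: open_comp => // z _; exact: continuous_fatou.
Qed.

Lemma open_web_domain n : open (web_domain n).
Proof. by apply: bigcup_open => l _; exact: open_core. Qed.

(** The heights of the two zones allow only a small E sin y, so E cos y has nearly the full size E
    of the exponential term. If positive, it would push [F z] over the right edge; hence it is
    negative and throws [F z] far to the left. *)
Lemma fatou_far_left n z : zone n z -> zone n.+1 (F z) -> z.1 <= - (a n + 8) ->
  (F z).1 <= - (a n.+1 + 8).
Proof.
move=> [z1 z2] [f1 f2] h; have a3 := radius_ge3 n; have a3' := radius_ge3 n.+1.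
have s1 := radiusS_ge n; have s2 := radiusS_le n; have E0 := expR_gt0 (a n).
have p4 : @pi R <= 4.
  by have [/andP[_ ?] _] := pihalf_02_cos_pihalf R; lra.
set E := expR (- z.1).
(* The margin 8 enters through exp 8 >= 2^8 = 256. *)
have E256 : 256 * expR (a n) <= E.
  have -> : E = expR (- z.1 - a n) * expR (a n) by rewrite -expRD subrK.
  rewrite ler_pM2r //; apply: le_trans (_ : expR 8 <= _); last by rewrite ler_expR; lra.
  have e1 : 2 <= expR 1 :> R by have := expR_ge1Dx (1 : R); lra.
  have -> : expR 8 = expR 1 ^+ 8 :> R by rewrite -expRM_natl mulr1.
  have -> : 256 = 2 ^+ 8 :> R by rewrite -natrX.
  by rewrite lerXn2r ?nnegrE//; lra.
have E1 : 1 + - z.1 <= E := expR_ge1Dx _.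
have Ez : - z.1 <= E / 2.
  have := @expR_ge1Dxn R (- z.1) 1; rewrite -/E factE /= => /(_ _) h2.
  have : 1 + (- z.1) ^+ 2 / 2 <= E by apply: h2; lra.
  nra.
have Es : `|E * sin z.2| <= 16 * a n.+1.
  have -> : E * sin z.2 = z.2 - (F z).2 by rewrite /E /F /=; ring.
  apply: le_trans (ler_normB _ _) _.
  have : tau * a n <= 8 * a n.+1 by nra.
  have : tau * a n.+1 <= 8 * a n.+1 by nra.
  lra.
have Ec : E * cos z.2 = (F z).1 - z.1 - 1 by rewrite /E /F /=; ring.
have csE : E <= `|E * cos z.2| + `|E * sin z.2|.
  have Ep : 0 < E := expR_gt0 _.
  rewrite !normrM (ger0_norm (ltW Ep)) -mulrDr ler_peMr ?(ltW Ep) //.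
  have := cos2Dsin2 z.2; rewrite -(real_normK (num_real (cos z.2))).
  rewrite -(real_normK (num_real (sin z.2))).
  by have := cos_max z.2; have := sin_max z.2; have := normr_ge0 (cos z.2);
     have := normr_ge0 (sin z.2); nra.
have [c0|c0] := leP 0 (E * cos z.2).
  by move: csE; rewrite (ger0_norm c0) Ec; lra.
by move: csE; rewrite (ltr0_norm c0) Ec; lra.
Qed.

(** The left bound of the domains: an orbit starting beyond the margin stays beyond it as long as it
    keeps to the zones, so it never enters a box. *)
Lemma core_gt l n z : core l n z -> - (a n + 8) < z.1.
Proof.
elim: l n z => [|l IH] n z; first by move=> [_]; lra.
move=> [h1 h2]; have := IH _ _ h2; rewrite !ltNge; apply: contra => h.
by apply: fatou_far_left => //; exact: core_zone h2.
Qed.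

Lemma web_domainF n z : web_domain n z -> zone n z /\ web_domain n.+1 (F z).
Proof.
move=> [[|l] _ h].
  by split; [case: h|exists 0%N => //; exact: fatou_box].
by case: h => h1 h2; split => //; exists l.
Qed.

Lemma closure_zone n z : closure (zone n) z -> z.1 <= a n /\ `|z.2| <= tau * a n.
Proof.
pose C := (fst @^-1` [set x | x <= a n])
  `&` ((fun z : R * R => `|z.2|) @^-1` [set y | y <= tau * a n]).
have cl : closed C.
  apply: closedI; apply: closed_comp; try exact: closed_le.
    by move=> w _; exact: continuous_fst.
  by move=> w _; apply: cvg_norm; exact: continuous_snd.
have sub : zone n `<=` C by move=> w [w1 w2]; split; exact: ltW.
by move=> /(closure_subset sub); rewrite -(proj1 (closure_id _) cl) => -[].
Qed.

(** The iterates stay in the closures of the successive domains. Either one of them lies on an edge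
    of its zone, which escapes, or all stay in the zones and outside the boxes, so their real parts
    are at most - a (n + i). *)
Lemma web_domain_boundary n z : closure (web_domain n) z -> ~ web_domain n z -> escapes z.
Proof.
move=> cz nz.
have cit i : closure (web_domain (n + i)) (iter i F z).
  elim: i => [|i IH]; first by rewrite addn0.
  rewrite addnS iterS => B /(continuous_fatou) hB.
  by have [w [/web_domainF[_ w1] w2]] := IH _ hB; exists (F w).
have [h|h] := pselect (forall i, zone (n + i) (iter i F z)); last first.
  have [i hi] : exists i, ~ zone (n + i) (iter i F z) by apply/existsNP.
  have esc : escapes (iter i F z).
    have sub : web_domain (n + i) `<=` zone (n + i) by move=> w /web_domainF[].
    have /closure_zone[z1 z2] := closure_subset sub (cit i).
    have [e1|e1] := ltP (iter i F z).1 (a (n + i)); last first.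
      by apply: right_escapes; have := radius_ge3 (n + i); lra.
    have [e2|e2] := ltP `|(iter i F z).2| (tau * a (n + i)); first by case: hi.
    apply: line_escapes; have {e2 z2}: `|(iter i F z).2| == tau * a (n + i).
      by rewrite eq_le z2 e2.
    rewrite eqr_norml => /andP[/orP[]/eqP e _].
      by exists (radius (n + i))%:Z; rewrite e mulrC.
    by exists (- (radius (n + i))%:Z); rewrite e mulrNz mulNr mulrC.
  elim: i {hi cit h} esc => // i IH; rewrite iterS => /escapesF; exact: IH.
(* As the orbit keeps to the zones, entering a later domain would place [z] in the first one. *)
have nG i : ~ web_domain (n + i) (iter i F z).
  elim: i => [|i IH]; first by rewrite addn0.
  rewrite addnS iterS => -[l _ hl]; apply: IH; exists l.+1 => //; split => //.
move=> M; exists (Num.trunc M).+1 => // i /= hi.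
rewrite lt_max; apply/orP; left.
have : ~ - a (n + i) < (iter i F z).1.
  by move=> hh; apply: (nG i); exists 0%N => //; split.
move=> /negP; rewrite -leNgt => hh.
apply: lt_le_trans (_ : a (n + i) <= _); last first.
  by rewrite ler0_norm; have := radius_ge3 (n + i); lra.
apply: lt_le_trans (truncnS_gt M) _; rewrite ler_nat.
by apply: leq_trans hi _; apply: leq_trans (radius_ge _); lia.
Qed.

Lemma web_domain_cover : \bigcup_n web_domain n = setT.
Proof.
apply/seteqP; split => // z _.
pose N := (Num.trunc (`|z.1| + `|z.2|)).+1; exists N => //; exists 0%N => //.
have h : `|z.1| + `|z.2| < a N.
  apply: lt_le_trans (truncnS_gt _) _; rewrite ler_nat -/N.
  by apply: leq_trans (radius_ge _); rewrite leq_addr.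
have := ler_norm z.1; have := ler_norm (- z.1); rewrite normrN => n1 n2.
have := normr_ge0 z.2; have := normr_ge0 z.1 => n3 n4; have t4 := tau_ge4.
by split; [split|]; nra.
Qed.

End Domains.
Arguments radius : simpl never.
Arguments core : simpl never.
(** * Simple connectivity of the domains *)

Section Deformation.
Variable R : realType.
Implicit Types (x y u v s t : R) (z w q : R * R) (l m n : nat).
Local Notation F := (@fatou_plane R).
Local Notation tau := (2 * @pi R).
Local Notation a n := ((radius R n)%:R : R).

Lemma continuous_near_eq (T U : topologicalType) (f g : T -> U) (p : T) :
  (\forall q \near p, g q = f q) -> {for p, continuous g} -> {for p, continuous f}.
Proof.
move=> e gc; rewrite /prop_for /continuous_at -(nbhs_singleton e).
exact: cvg_trans (near_eq_cvg e) gc.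
Qed.

(* The half-plane [1 <= z.1] contains all the slits [F] makes along the lines,
   so keeping it fixed is what makes [D] liftable through [F]. *)
Definition retracts l n (D : R * (R * R) -> R * R) :=
  [/\ forall s z, core l n z -> {for (s, z), continuous D},
      forall s z, core l n z -> core l n (D (s, z)),
      forall z, core l n z -> D (0, z) = z,
      forall z, core l n z -> box n (D (1, z)) &
      forall s z, core l n z ->
        (1 <= z.1 -> D (s, z) = z) /\ (z.1 < 1 -> (D (s, z)).1 < 1)].

Lemma open_left (c : R) : open [set z : R * R | z.1 < c].
Proof.
rewrite -[X in open X]/(fst @^-1` [set x | x < c]); apply: open_comp.
  by move=> z _; exact: continuous_fst.
exact: open_lt.
Qed.

Lemma open_right (c : R) : open [set z : R * R | c < z.1].
Proof.
rewrite -[X in open X]/(fst @^-1` [set x | c < x]); apply: open_comp.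
  by move=> z _; exact: continuous_fst.
exact: open_gt.
Qed.

Definition strip_index z := Num.floor (z.2 / tau).

Lemma strip_indexP j z : strip j z -> strip_index z = j.
Proof.
have tau0 : 0 < tau by rewrite mulr_gt0 ?pi_gt0.
move=> /andP[h1 h2]; apply: floor_def; apply/andP; split.
  by rewrite ler_pdivlMr // ltW.
by rewrite ltr_pdivrMr // intrD mulrDl mul1r.
Qed.

Lemma strip_of_left z : (F z).1 < 2 -> strip (strip_index z) z.
Proof.
move=> h; have [lz|[j sj]] := line_or_strip z; last by rewrite (strip_indexP sj).
by have [_] := fatou_line lz; lra.
Qed.

Lemma open_strip j : open [set z : R * R | strip j z].
Proof.
have -> : [set z : R * R | strip j z] =
  (snd @^-1` [set y | j%:~R * tau < y]) `&` (snd @^-1` [set y | y < j%:~R * tau + tau]).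
  by apply/seteqP; split => z; [move=> /andP[]|move=> [h1 h2]; apply/andP].
apply: openI; (apply: open_comp; first by move=> z _; exact: continuous_snd).
  exact: open_gt.
exact: open_lt.
Qed.

(** The horizontal edges of the zone are integer multiples of [tau], so no strip crosses them. *)
Lemma strip_zone j n z w : strip j z -> strip j w ->
  `|z.2| < tau * a n -> `|w.2| < tau * a n.
Proof.
have tau0 : 0 < tau by rewrite mulr_gt0 ?pi_gt0.
rewrite /strip !ltr_norml => /andP[h1 h2] /andP[h3 h4] /andP[h5 h6].
have hj : j%:~R * tau < a n * tau by lra.
have hj' : - a n * tau < (j + 1)%:~R * tau by rewrite intrD; lra.
rewrite ltr_pM2r // -[a n]/((radius R n)%:~R) ltr_int in hj.
rewrite ltr_pM2r // -[a n]/((radius R n)%:~R) -mulrNz ltr_int in hj'.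
have k1 : (j + 1)%:~R * tau <= a n * tau.
  by rewrite ler_pM2r // -[a n]/((radius R n)%:~R) ler_int; lia.
have k2 : - a n * tau <= j%:~R * tau.
  by rewrite ler_pM2r // -[a n]/((radius R n)%:~R) -mulrNz ler_int; lia.
rewrite intrD in k1; apply/andP; split; lra.
Qed.

Lemma core_succ l n z : core l.+1 n z -> zone n z /\ core l n.+1 (F z).
Proof. by []. Qed.

Section Lift.
Variables (l n : nat) (D : R * (R * R) -> R * R).
Hypothesis DP : retracts l n.+1 D.

(** The two cases agree for 1 <= Re F < 2, since [D] is the identity on Re >= 1. This overlap gives
    continuity without using a branch where Re >= 2. *)
Definition lift p : R * R :=
  if 1 <= (F p.2).1 then p.2 else branch (strip_index p.2) (D (p.1, F p.2)).

Lemma liftE j s z : strip j z -> (F z).1 < 2 -> core l n.+1 (F z) ->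
  lift (s, z) = branch j (D (s, F z)).
Proof.
case: DP => _ _ _ _ Df sj F2 cF; rewrite /lift /=; case: ifPn => [h|_].
  by rewrite (Df s _ cF).1 // branchK.
by rewrite (strip_indexP sj).
Qed.

Lemma lift_left s z : (F z).1 < 2 -> core l n.+1 (F z) -> (D (s, F z)).1 < 2.
Proof.
case: DP => _ _ _ _ Df F2 cF; have [h|h] := leP 1 (F z).1.
  by rewrite (Df s _ cF).1.
by have := (Df s _ cF).2 h; lra.
Qed.

Lemma lift_strip s z : (F z).1 < 2 -> core l n.+1 (F z) ->
  strip (strip_index z) (lift (s, z)) /\ F (lift (s, z)) = D (s, F z).
Proof.
move=> F2 cF; rewrite (liftE s (strip_of_left F2)) //.
by apply: branchP; exact: lift_left.
Qed.

Lemma lift_continuous s z : core l.+1 n z -> {for (s, z), continuous lift}.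
Proof.
move=> /core_succ[_ cF].
have cF2 : {for (s, z), continuous (fun p : R * (R * R) => F p.2)}.
  by apply: (@continuous_comp _ _ _ snd F); [exact: cvg_snd|exact: continuous_fatou].
have [h|h] := ltP 1 (F z).1.
  apply: (@continuous_near_eq _ _ _ snd); last exact: cvg_snd.
  have : \forall p \near (s, z), 1 < (F p.2).1.
    apply: (cF2 [set w | 1 < w.1]); apply: open_nbhs_nbhs; split => //.
    exact: open_right.
  by move=> n1; apply: filterS n1 => p hp; rewrite /lift ltW.
have F2 : (F z).1 < 2 by lra.
have sz := strip_of_left F2; set j := strip_index z in sz.
apply: (@continuous_near_eq _ _ _ (fun p => branch j (D (p.1, F p.2)))).
  have n1 : \forall p \near (s, z), strip j p.2.
    have cs2 : {for (s, z), continuous (fun p : R * (R * R) => p.2)} by exact: cvg_snd.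
    apply: (cs2 [set w | strip j w]); apply: open_nbhs_nbhs; split => //.
    exact: open_strip.
  have n2 : \forall p \near (s, z), (F p.2).1 < 2.
    apply: (cF2 [set w | w.1 < 2]); apply: open_nbhs_nbhs; split => //.
    exact: open_left.
  have n3 : \forall p \near (s, z), core l n.+1 (F p.2).
    by apply: (cF2 (core l n.+1)); apply: open_nbhs_nbhs; split => //; exact: open_core.
  by near=> p; rewrite -liftE -?surjective_pairing //; near: p.
apply: (@continuous_comp _ _ _ (fun p : R * (R * R) => D (p.1, F p.2)) (branch j)).
  apply: (@continuous_comp _ _ _ (fun p : R * (R * R) => (p.1, F p.2)) D).
    by apply: continuous_pair; [exact: cvg_fst|exact: cF2].
  by case: DP => Dc _ _ _ _; exact: Dc.
by apply: branch_continuous; exact: lift_left.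
Unshelve. all: by end_near.
Qed.

Lemma lift_right s z : 1 <= (F z).1 -> lift (s, z) = z.
Proof. by rewrite /lift /= => ->. Qed.

Lemma lift_fixed s z : 1 <= z.1 -> lift (s, z) = z.
Proof. by move=> h; apply: lift_right; have := fatou_re_right h; lra. Qed.

Lemma fatou_lift s z : core l n.+1 (F z) -> F (lift (s, z)) = D (s, F z).
Proof.
move=> cF; have [h|h] := leP 1 (F z).1; last by apply: (lift_strip s _ cF).2; lra.
by rewrite lift_right //; case: DP => _ _ _ _ Df; rewrite (Df s _ cF).1.
Qed.

(** The lift stays in the strip of [z], which controls the height. It cannot reach Re >= 1 when Re F
    z < 1: its image would then have real part at least 3 / 2, whereas [D] stays in Re < 1. *)
Lemma lift_zone s z : core l.+1 n z -> zone n (lift (s, z)).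
Proof.
move=> /core_succ[zz cF]; have [h|h] := leP 1 (F z).1; first by rewrite lift_right.
have F2 : (F z).1 < 2 by lra.
have [sl Fl] := lift_strip s F2 cF; split; last first.
  by apply: (strip_zone (strip_of_left F2) sl); case: zz.
have [l1|l1] := leP 1 (lift (s, z)).1; last by have := radius_ge3 R n; lra.
have := fatou_re_right l1; rewrite Fl.
by case: DP => _ _ _ _ Df; have := (Df s _ cF).2 h; lra.
Qed.

Lemma lift_lt1 s z : core l.+1 n z -> z.1 < 1 -> (lift (s, z)).1 < 1.
Proof.
move=> /core_succ[zz cF] z1; have [h|h] := leP 1 (F z).1; first by rewrite lift_right.
have F2 : (F z).1 < 2 by lra.
have [sl Fl] := lift_strip s F2 cF.
rewrite ltNge; apply/negP => l1; have := fatou_re_right l1; rewrite Fl.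
by case: DP => _ _ _ _ Df; have := (Df s _ cF).2 h; lra.
Qed.

Lemma lift_core s z : core l.+1 n z -> core l.+1 n (lift (s, z)).
Proof.
move=> cz; split; first exact: lift_zone.
by case/core_succ: cz => _ cF; rewrite fatou_lift //; case: DP => _ DG _ _ _; exact: DG.
Qed.

Lemma lift0 z : core l.+1 n z -> lift (0, z) = z.
Proof.
move=> /core_succ[_ cF]; have [h|h] := leP 1 (F z).1; first exact: lift_right.
have F2 : (F z).1 < 2 by lra.
rewrite (liftE 0 (strip_of_left F2)) //; case: DP => _ _ D0 _ _.
by rewrite D0 // branchK //; exact: strip_of_left.
Qed.

Lemma lift1 z : core l.+1 n z -> core 1 n (lift (1, z)).
Proof.
move=> cz; split; first exact: lift_zone.
by case/core_succ: cz => _ cF; rewrite fatou_lift //; case: DP => _ _ _ D1 _; exact: D1.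
Qed.

End Lift.

(** For t in [0, 1] the maximum leaves points with Re >= - 1 fixed and moves the others horizontally
    towards Re = - 1. *)
Definition push t z : R * R := (Num.max z.1 (z.1 + t * (- 1 - z.1)), z.2).

Lemma push0 z : push 0 z = z.
Proof. by rewrite /push mul0r addr0 maxxx -surjective_pairing. Qed.

Lemma push_fixed t z : 0 <= t -> - 1 <= z.1 -> push t z = z.
Proof.
by move=> t0 z1; rewrite /push max_l -?surjective_pairing //; nra.
Qed.

Lemma push_left t z : 0 <= t <= 1 -> z.1 < - 1 -> z.1 <= (push t z).1 <= - 1.
Proof.
move=> /andP[t0 t1] z1; rewrite /push /= max_r; last by nra.
by apply/andP; split; nra.
Qed.

(** For fixed y, y - exp (- x) sin y is monotone in x, so its values lie between those at the two
    ends. *)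
Lemma fatou_between z x : z.1 <= x <= - 1 ->
  (F (x, z.2)).2 <= Num.max (F z).2 (F (- 1, z.2)).2 /\
  Num.min (F z).2 (F (- 1, z.2)).2 <= (F (x, z.2)).2.
Proof.
move=> /andP[x1 x2]; rewrite ge_min le_max /F /=.
have e1 : expR (- x) <= expR (- z.1) by rewrite ler_expR; lra.
have e2 : expR (- - 1) <= expR (- x) by rewrite ler_expR; lra.
have [s0|s0] := leP 0 (sin z.2).
  by split; apply/orP; [right|left]; nra.
by split; apply/orP; [left|right]; nra.
Qed.

(** The image must stay in the next box. Its height lies between the heights of two images in that
    box, namely those of [z] and of the point at Re = - 1; the real part is treated according to the
    sign of cos y. *)
Lemma push_core1 n t z : 0 <= t <= 1 -> core 1 n z -> core 1 n (push t z).
Proof.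
move=> t01 cz; have [z1|z1] := leP (- 1) z.1.
  by rewrite push_fixed //; case/andP: t01.
have /andP[x1 x2] := push_left t01 z1; set x := (push t z).1 in x1 x2.
have -> : push t z = (x, z.2) by [].
have zgt := core_gt cz; move: cz => /core_succ[[z1' z2] [[F1 F2] F3]].
have a3 := radius_ge3 R n; have a3' := radius_ge3 R n.+1.
have [[g1 g2] g3] : box n.+1 (F (- 1, z.2)).
  by apply: fatou_box; split; [split|] => //=; lra.
have [b1 b2] := @fatou_between z x (introT andP (conj x1 x2)).
split; first by split => //=; lra.
have im : `|(F (x, z.2)).2| < tau * a n.+1.
  move: F2 g2 b1 b2; rewrite !ltr_norml le_max ge_min => /andP[? ?] /andP[? ?].
  by move=> /orP[] ? /orP[] ?; apply/andP; split; lra.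
(* This guards the left edge when cos y >= 0: then Re F >= x + 1, and x > - (a n + 8). *)
have big : a n + 8 <= a n.+1 + 1.
  have := radiusS_ge R n; have := expR_ge1Dx (a n).
  have e1 : 2 <= expR 1 :> R by have := expR_ge1Dx (1 : R); lra.
  have : expR 3 <= expR (a n) by rewrite ler_expR.
  have -> : expR 3 = expR 1 ^+ 3 :> R by rewrite -expRM_natl mulr1.
  have : 2 ^+ 3 <= expR 1 ^+ 3 :> R by rewrite lerXn2r ?nnegrE//; lra.
  rewrite !exprS expr0; lra.
(* This guards the right edge: if exp (- x) cos y >= 1, it shows that pushing to the right does not
   increase x + exp (- x) cos y. *)
have tangent : expR (- z.1) >= expR (- x) * (1 + (x - z.1)).
  have -> : expR (- z.1) = expR (- x) * expR (x - z.1).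
    by rewrite -expRD; congr expR; ring.
  by rewrite ler_pM2l ?expR_gt0 //; exact: expR_ge1Dx.
have E0 := expR_gt0 (- x).
have El : expR (- x) <= expR (- z.1) by rewrite ler_expR; lra.
move: F1 F3; rewrite /fatou_plane /= => F1 F3.
split; [split => //|]; rewrite /fatou_plane /=.
  have [c0|c0] := leP 0 (cos z.2); last by nra.
  have [c1|c1] := leP 1 (expR (- x) * cos z.2); last by lra.
  have : expR (- x) * (1 + (x - z.1)) * cos z.2 <= expR (- z.1) * cos z.2.
    by rewrite ler_wpM2r.
  nra.
have [c0|c0] := leP 0 (cos z.2); first by have := mulr_ge0 (ltW E0) c0; lra.
nra.
Qed.

Lemma push_box n z : zone n z -> box n (push 1 z).
Proof.
move=> [z1 z2]; have a3 := radius_ge3 R n; rewrite /push mul1r subrKC.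
split; first by split => //=; rewrite gt_max z1 /=; lra.
by rewrite /= lt_max; apply/orP; right; lra.
Qed.

Lemma continuous_push_comp (T : topologicalType) (f : T -> R) (g : T -> R * R) (p : T) :
  {for p, continuous f} -> {for p, continuous g} ->
  {for p, continuous (fun o => push (f o) (g o))}.
Proof.
move=> fc gc.
have g1 : {for p, continuous (fun o => (g o).1)}.
  by apply: (@continuous_comp _ _ _ g fst); [exact: gc|exact: continuous_fst].
have g2 : {for p, continuous (fun o => (g o).2)}.
  by apply: (@continuous_comp _ _ _ g snd); [exact: gc|exact: continuous_snd].
apply: (@continuous_pair T R R
  (fun o => Num.max (g o).1 ((g o).1 + f o * (- 1 - (g o).1))) (fun o => (g o).2)) => //.
apply: (@continuous_max R T (fun o => (g o).1)
  (fun o => (g o).1 + f o * (- 1 - (g o).1))) => //.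
apply: cvgD; first exact: g1.
by apply: cvgM; [exact: fc|apply: cvgB; [exact: cvg_cst|exact: g1]].
Qed.

(** Induction on l. In the first half of the time the retraction at the next scale is lifted through
    [F], which brings points into [core 1 n]; in the second half [push] moves them into the box. *)
Lemma retraction l n : exists D, retracts l n D.
Proof.
elim: l n => [|l IH] n.
  exists snd; split.
  - by move=> s z _; exact: cvg_snd.
  - by move=> s z cz.
  - by move=> z _.
  - by move=> z cz.
  - by move=> s z _; split.
have [D DP] := IH n.+1.
exists (fun p => push (clamp (2 * p.1 - 1)) (lift D (clamp (2 * p.1), p.2))).
have c10 s : s <= 1 / 2 -> clamp (2 * s - 1) = 0 by move=> ?; apply: clamp_le0; lra.
have c21 s : 1 / 2 <= s -> clamp (2 * s) = 1 by move=> ?; apply: clamp_ge1; lra.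
split.
- move=> s z cz.
  have c2 : {for (s, z), continuous (fun p : R * (R * R) => 2 * p.1)}.
    by apply: cvgM; [exact: cvg_cst|exact: cvg_fst].
  have c3 : {for (s, z), continuous (fun p : R * (R * R) => 2 * p.1 - 1)}.
    by apply: cvgB; [exact: c2|exact: cvg_cst].
  apply: continuous_push_comp; first exact: (continuous_clamp_comp c3).
  apply: (@continuous_comp _ _ _ (fun p : R * (R * R) => (clamp (2 * p.1), p.2))
    (lift D)).
    apply: continuous_pair; last exact: cvg_snd.
    exact: (continuous_clamp_comp c2).
  exact: lift_continuous DP _ _ cz.
- move=> s z cz /=; have [h|h] := leP s (1 / 2).
    by rewrite c10 // push0; exact: lift_core.
  rewrite c21 ?ltW //; apply: (@core_le R 1 l.+1) => //.
  by apply: push_core1; [exact: clamp01|exact: lift1 DP _ cz].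
- move=> z cz /=; rewrite c10 ?push0; last by lra.
  by rewrite mulr0 clamp_le0 // (lift0 DP cz).
- move=> z cz /=; rewrite [clamp (2 * 1 - 1)]clamp_ge1; last by lra.
  by apply: push_box; exact: lift_zone DP _ _ cz.
- move=> s z cz /=; have /andP[t0 t1] := clamp01 (2 * s - 1); split => z1.
    by rewrite lift_fixed // push_fixed //; lra.
  have := lift_lt1 DP (clamp (2 * s)) cz z1; set w := lift _ _ => w1.
  by rewrite gt_max w1 /=; have [h|h] := leP (- 1) w.1; nra.
Qed.

(** After the retraction, the box is shrunk linearly to the origin. *)
Lemma core_contractible l n : exists D, contracts (core (R := R) l n) 0 D.
Proof.
have [D [Dc DG D0 D1 _]] := retraction l n.
exists (fun p => (1 - clamp (2 * p.1 - 1)) *: D (clamp (2 * p.1), p.2)).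
have c10 s : s <= 1 / 2 -> clamp (2 * s - 1) = 0 by move=> ?; apply: clamp_le0; lra.
have c21 s : 1 / 2 <= s -> clamp (2 * s) = 1 by move=> ?; apply: clamp_ge1; lra.
split.
- move=> s z _ cz.
  have c2 : {for (s, z), continuous (fun p : R * (R * R) => 2 * p.1)}.
    by apply: cvgM; [exact: cvg_cst|exact: cvg_fst].
  have c3 : {for (s, z), continuous (fun p : R * (R * R) => 2 * p.1 - 1)}.
    by apply: cvgB; [exact: c2|exact: cvg_cst].
  have d1 : {for (s, z), continuous (fun p : R * (R * R) => 1 - clamp (2 * p.1 - 1))}.
    by apply: cvgB; [exact: cvg_cst|exact: (continuous_clamp_comp c3)].
  have d2 : {for (s, z), continuous (fun p : R * (R * R) => D (clamp (2 * p.1), p.2))}.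
    apply: (@continuous_comp _ _ _ (fun p : R * (R * R) => (clamp (2 * p.1), p.2)) D).
      apply: continuous_pair; last exact: cvg_snd.
      exact: (continuous_clamp_comp c2).
    exact: Dc.
  by apply: cvgZ; [exact: d1|exact: d2].
- move=> s z _ cz /=; have [h|h] := leP s (1 / 2).
    by rewrite c10 // subr0 scale1r; exact: DG.
  rewrite c21 ?ltW //; apply: (@core_le R 0 l) => //.
  have := clamp01 (2 * s - 1); set t := clamp _ => /andP[t0 t1].
  have [[d1 d2] d3] := D1 _ cz; set w := D _ in d1 d2 d3 *.
  have a3 := radius_ge3 R n.
  have -> : (1 - t) *: w = ((1 - t) * w.1, (1 - t) * w.2) by [].
  split; [split|] => /=; try nra.
  rewrite normrM ger0_norm; last by lra.
  by apply: le_lt_trans d2; rewrite ler_piMl //; lra.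
- move=> z cz /=; rewrite c10; last by lra.
  by rewrite subr0 scale1r mulr0 clamp_le0 // D0.
- by move=> z cz /=; rewrite [clamp (2 * 1 - 1)]clamp_ge1 ?subrr ?scale0r //; lra.
Qed.

Lemma web_domain_simply_connected n : simply_connected R (web_domain (R := R) n).
Proof.
apply: simply_connected_bigcup => [l|l|l]; [exact: open_core|exact: coreS|].
by have [D hD] := core_contractible l n; exact: contractible_simply_connected hD.
Qed.

Lemma web_domain_connected n : connected (web_domain (R := R) n).
Proof.
have z0 : web_domain n (0 : R * R).
  have a3 := radius_ge3 R n; have t4 := tau_ge4 R; exists 0%N => //.
  by split; [split|]; rewrite /= ?normr0; nra.
apply: (@connected_from (R * R)%type _ 0) => z Gz.
have [gamma [gc gG g0 g1]] := (web_domain_simply_connected n).1 _ _ Gz z0.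
exists (gamma @` `[0, 1]); split => //.
- by apply: connected_continuous_connected => //; exact: segment_connected.
- by exists 0; rewrite //= in_itv/= lexx ler01.
- by exists 1; rewrite //= in_itv/= lexx ler01.
Qed.

End Deformation.
(** * Back to the complex plane *)

Section Transfer.
Variable R : realType.
Implicit Types (p q : R * R) (z w : R[i]).
Local Notation F := (@fatou_plane R).
Local Open Scope complex_scope.

Definition of_plane p : R[i] := p.1 +i* p.2.
Definition to_plane z : R * R := (complex.Re z, complex.Im z).

Lemma of_planeK : cancel of_plane to_plane.
Proof. by case. Qed.

Lemma to_planeK : cancel to_plane of_plane.
Proof. by case. Qed.

Lemma norm_of_plane p : `|of_plane p| = (enorm p)%:C.
Proof. by rewrite normc_def. Qed.

Lemma of_planeB p q : of_plane p - of_plane q = of_plane (p - q).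
Proof. by []. Qed.

Lemma continuous_of_plane : continuous of_plane.
Proof.
move=> p A /nbhs_ballP[e /= e0 hA].
have /andP[/eqP e1 e2] : (complex.Im e == 0) && (0 < complex.Re e).
  by move: e0; rewrite ltcE.
have n1 : \forall q \near p, `|p.1 - q.1| < complex.Re e / 2.
  by have /cvgr_dist_lt := @continuous_fst _ p; apply; rewrite divr_gt0.
have n2 : \forall q \near p, `|p.2 - q.2| < complex.Re e / 2.
  by have /cvgr_dist_lt := @continuous_snd _ p; apply; rewrite divr_gt0.
suff : \forall q \near p, A (of_plane q) by [].
near=> q; apply: hA; rewrite /ball /= of_planeB norm_of_plane ltcE /= e1 eqxx /=.
apply: le_lt_trans (enorm_le_sum _) _.
have m1 : `|p.1 - q.1| < complex.Re e / 2 by near: q.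
have m2 : `|p.2 - q.2| < complex.Re e / 2 by near: q.
by rewrite -[(p - q).1]/(p.1 - q.1) -[(p - q).2]/(p.2 - q.2); lra.
Unshelve. all: by end_near.
Qed.

Lemma continuous_to_plane : continuous to_plane.
Proof.
move=> z A /nbhs_ballP[e /= e0 hA].
have e0' : 0 < e%:C by rewrite ltcE /= eqxx.
suff : \forall w \near z, A (to_plane w) by [].
apply/nbhs_ballP; exists e%:C => //= w.
rewrite /ball /= -{1}(to_planeK z) -{1}(to_planeK w) of_planeB norm_of_plane.
rewrite ltcE /= eqxx /= => h; apply: hA; split; rewrite /ball /=; apply: le_lt_trans h.
  exact: (abs1_le_enorm (to_plane z - to_plane w)).
exact: (abs2_le_enorm (to_plane z - to_plane w)).
Qed.

Lemma fatou_of_plane p : fatou_map (of_plane p) = of_plane (F p).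
Proof.
case: p => x y; rewrite /fatou_map /of_plane /fatou_plane /= cosN sinN.
rewrite -[LHS]/((x + 1 + expR (- x) * cos y) +i* (y + 0 + expR (- x) * - sin y)).
by congr (_ +i* _); ring.
Qed.

Lemma iter_of_plane n p : iter n (@fatou_map R) (of_plane p) = of_plane (iter n F p).
Proof. by elim: n => // n IH; rewrite !iterS IH fatou_of_plane. Qed.

Lemma escapes_of_plane p : escapes p -> escaping_set (@fatou_map R) (of_plane p).
Proof.
move=> h A [M [Mr hM]].
(* The filter at infinity in [R[i]] is generated by real bounds, so [M] can be compared through its
   real part. *)
have /eqP M0 : complex.Im M == 0.
  by move: Mr; rewrite realE !lecE /= => /orP[] /andP[] //; rewrite eq_sym.
have [N _ hN] := h (complex.Re M); exists N => // n /hN /= Mn.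
apply: hM; rewrite iter_of_plane norm_of_plane ltcE /= M0 eqxx /=.
by apply: lt_le_trans Mn _; rewrite ge_max abs1_le_enorm abs2_le_enorm.
Qed.

End Transfer.

(** * Invariance under homeomorphisms and conclusion *)

Lemma within_continuous_comp (S V W : topologicalType) (A : set S)
    (f : S -> V) (g : V -> W) :
  {within A, continuous f} -> continuous g -> {within A, continuous (g \o f)}.
Proof.
move=> /subspace_continuousP fc gc; apply/subspace_continuousP => s As.
exact: (@cvg_comp _ _ _ f g _ _ _ (fc s As) (gc (f s))).
Qed.

Section Homeomorphism.
Variables (R : realType) (T U : topologicalType) (h : T -> U) (k : U -> T).
Hypotheses (hc : continuous h) (kc : continuous k) (hK : cancel h k) (kK : cancel k h).

Lemma preimage_image (G : set T) : k @^-1` G = h @` G.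
Proof.
apply/seteqP; split => [u Gu|_ [t Gt <-]]; last by rewrite /preimage /= hK.
by exists (k u); rewrite ?kK.
Qed.

Lemma connected_homeo (G : set T) : connected G -> connected (k @^-1` G).
Proof.
rewrite preimage_image => Gc; apply: connected_continuous_connected => //.
exact: continuous_subspaceT.
Qed.

Lemma simply_connected_homeo (G : set T) :
  simply_connected R G -> simply_connected R (k @^-1` G).
Proof.
move=> [path loop]; split=> [x y Gx Gy|x gamma [gc gG g0 g1]].
  have [gamma [gc gG g0 g1]] := path _ _ Gx Gy.
  exists (h \o gamma); split; rewrite /= ?g0 ?g1 ?kK //.
    exact: within_continuous_comp.
  by move=> _ [t t01 <-]; rewrite /preimage /= hK; apply: gG; exists t.
have [|H [Hc HG H0 H1 Hx]] := loop (k x) (k \o gamma).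
  split; rewrite /= ?g0 ?g1 //; first exact: within_continuous_comp.
  by move=> _ [t t01 <-]; apply: gG; exists t.
exists (h \o H); split.
- exact: within_continuous_comp.
- by move=> _ [t t01 <-]; rewrite /preimage /= hK; apply: HG; exists t.
- by move=> t t01; rewrite /= H0 // kK.
- by move=> t t01; rewrite /= H1 // kK.
- by move=> s s01; have [e1 e2] := Hx s s01; rewrite /= e1 e2 kK.
Qed.

End Homeomorphism.

(** [A] lies on one side of any separation of [B]; the closure of that side then contains [B] and
    meets the other side. *)
Lemma connected_between (T : topologicalType) (A B : set T) :
  connected A -> A `<=` B -> B `<=` closure A -> connected B.
Proof.
move=> Ac AB BA; apply: contrapT => /connectedPn[E [E0 EB sep]].
have [h|h] : A `<=` E false \/ A `<=` E true.
- by apply: connected_subset Ac => //; rewrite -EB.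
- have [t Et] := E0 true; move: sep => [S _].
  have Bt : B t by rewrite EB; right.
  have : (closure (E false) `&` E true) t.
    by split => //; apply: closure_subset h _ (BA _ Bt).
  by rewrite S.
- have [t Et] := E0 false; move: sep => [_ S].
  have Bt : B t by rewrite EB; left.
  have : (E false `&` closure (E true)) t.
    by split => //; apply: closure_subset h _ (BA _ Bt).
  by rewrite S.
Qed.

Theorem theorem1p1 (R : realType) :
  spiders_web (escaping_set (@fatou_map R)).
Proof.
split.
  apply: (@connected_between _ (@to_plane R @^-1` @reaches R)).
  - apply: (connected_homeo (@continuous_of_plane R) (@of_planeK R) (@to_planeK R)).
    exact: reaches_connected.
  - by move=> z /reaches_escapes/escapes_of_plane; rewrite to_planeK.
  - move=> z _ A zA.
    have hA : nbhs (to_plane z) (@of_plane R @^-1` A).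
      by apply: continuous_of_plane; rewrite to_planeK.
    have : closure (@reaches R) (to_plane z) by rewrite reaches_dense.
    move=> /(_ _ hA)[q [rq Aq]]; exists (of_plane q); split => //.
    by rewrite /preimage /= of_planeK.
exists (fun n => @to_plane R @^-1` @web_domain R n); split; last first.
  by rewrite -preimage_bigcup web_domain_cover preimage_setT.
move=> n; split.
- split.
  + exists (of_plane 0); exists 0%N => //.
    have a3 := radius_ge3 R n; have t4 := tau_ge4 R.
    by split; [split|]; rewrite /= ?normr0; nra.
  + apply: open_comp; last exact: open_web_domain.
    by move=> z _; exact: continuous_to_plane.
  + apply: (connected_homeo (@continuous_of_plane R) (@of_planeK R) (@to_planeK R)).
    exact: web_domain_connected.
- apply: (simply_connected_homeo (@continuous_of_plane R)
    (@continuous_to_plane R) (@of_planeK R) (@to_planeK R)).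
  exact: web_domain_simply_connected.
- have a3 := radius_ge3 R n; have t4 := tau_ge4 R.
  (* The sum of the bounds on the two coordinates, from [core_gt] and [core_zone]. *)
  pose b : R := (radius R n)%:R + 8 + 2 * pi * (radius R n)%:R.
  exists (b%:C)%C; split; first by rewrite realE !lecE /= eqxx le_total.
  move=> M bM z [l _ hl]; apply/ltW/(le_lt_trans _ bM).
  rewrite -(to_planeK z) norm_of_plane lecE /= eqxx /=.
  apply: le_trans (enorm_le_sum _) _; have x1 := core_gt hl.
  have [x2 y1] := core_zone hl; rewrite /b.
  have : `|(to_plane z).1| <= (radius R n)%:R + 8.
    by rewrite ler_norml; apply/andP; split; lra.
  lra.
- by move=> z [l _ hl]; exists l => //; exact: core_sub.
- move=> z [cz nz]; rewrite -(to_planeK z).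
  apply/escapes_of_plane/(@web_domain_boundary _ n).
    move=> A zA; have hA : nbhs z (@to_plane R @^-1` A) by exact: continuous_to_plane.
    by have [w [Gw Aw]] := cz _ hA; exists (to_plane w).
  move=> Gz; apply: nz; apply: open_nbhs_nbhs; split => //.
  apply: open_comp; last exact: open_web_domain.
  by move=> w _; exact: continuous_to_plane.
Qed.
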